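(* Let $t\ge1$ and let $(\mathrm{Enc}^t,\mathrm{Dec}^t)$ be an $\varepsilon$-secure quantum non-malleable code against $\mathsf{LO}^t_{(e_1,\dots,e_t)}$ which is augmented at the first share, with message length $k$ qubits and blocklength $n$. Let $0\le\lambda<k$ and $0\le a\le\min(\lambda,e_1)$ be integers, and let $(\mathrm{Enc},\mathrm{Dec})$ be the $(t+1)$-share code for $(k-\lambda)$-qubit messages defined by $\mathrm{Enc}(\sigma_M)=((\mathrm{Enc}^t)_{ME}\otimes\mathrm{id}_{\hat E})(\sigma_M\otimes\Phi^{\otimes\lambda}_{E\hat E})$ (with $\hat E$ as the $(t+1)$-st share), and $\mathrm{Dec}$ which applies $\mathrm{Dec}^t$ to the first $t$ shares obtaining $M'E'$, measures $\{\Phi^{\otimes\lambda},\mathbb I-\Phi^{\otimes\lambda}\}$ on $E'$ and the $(t+1)$-st share, and outputs $M'$ on the first outcome and $\bot$ otherwise. Then $(\mathrm{Enc},\mathrm{Dec})$ is an $(\varepsilon+2^{1+a-\lambda})$-secure quantum tamper-detection code against $\mathsf{LO}^{t+1}_{(e_1-a,e_2,\dots,e_t,a)}$, with message length $k-\lambda$ and blocklength $n+\lambda$.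
   Context: A quantum code on $t$ shares is a pair of CPTP maps $\mathrm{Enc}:\mathcal L(\mathcal H_M)\to\mathcal L(\mathcal H_{X_1}\otimes\cdots\otimes\mathcal H_{X_t})$ and $\mathrm{Dec}$ in the reverse direction (the decoder may output a special state $\bot$ orthogonal to $\mathcal H_M$), with $(\mathrm{Dec}\circ\mathrm{Enc}\otimes\mathrm{id})(\sigma_{M\hat M})=\sigma_{M\hat M}$. $\Phi^{\otimes\lambda}_{E\hat E}$ denotes $\lambda$ EPR pairs. The class $\mathsf{LO}^t_{(e_1,\dots,e_t)}$ consists of adversaries $\mathcal A=(\Lambda_1,\dots,\Lambda_t,|\psi\rangle_{E_1\cdots E_t})$ with $|E_i|\le e_i$ qubits, each $\Lambda_i$ a CPTP map from $X_iE_i$ to $X_iE_i'$; the tampered codeword is obtained by applying $\Lambda_1\otimes\cdots\otimes\Lambda_t$ to the codeword tensored with $\psi$. For message $\sigma_M$ with canonical purification $\sigma_{M\hat M}$, let $\eta$ be the state on $M'\hat M E'_1\cdots E'_t$ after tampering and decoding. Non-malleable with error $\varepsilon$: for every $\mathcal A$ there exist $p_{\mathcal A}\in[0,1]$ and $\gamma_{M'}$ depending only on $\mathcal A$ with $\|\eta_{M'\hat M}-(p_{\mathcal A}\sigma_{M\hat M}+(1-p_{\mathcal A})\gamma_{M'}\otimes\sigma_{\hat M})\|_1\le\varepsilon$ for all $\sigma_M$. Augmented at share $i$ with error $\varepsilon$: for every $\mathcal A$ there exist $p_{\mathcal A}\in[0,1]$ and states $\zeta_{E'_i},\gamma_{M'E'_i}$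 depending only on $\mathcal A$ such that for all $\sigma_M$, $\|\eta_{M'\hat ME'_i}-(p_{\mathcal A}\sigma_{M\hat M}\otimes\zeta_{E'_i}+(1-p_{\mathcal A})\gamma_{M'E'_i}\otimes\sigma_{\hat M})\|_1\le\varepsilon$. Tamper-detection code with error $\varepsilon$: the non-malleability condition with $\gamma_{M'}=\bot_{M'}$. *)

(* Defs.v *)
(* Finite-dimensional quantum information over the complex
   numbers C := R[i], R a realType (mathcomp-real-closed's complex numbers).
   Operators on a Hilbert space with orthonormal basis indexed by a finType T
   are represented as functions  T -> T -> C  (matrices). *)
From HB Require Import structures.
From mathcomp Require Import all_boot all_order all_algebra.
From mathcomp Require Import reals complex.
From Stdlib Require Import ClassicalEpsilon.
Set Implicit Arguments.
Unset Strict Implicit.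
Unset Printing Implicit Defensive.
Import Order.TTheory GRing.Theory Num.Theory.
Local Open Scope ring_scope.
Local Open Scope complex_scope.

(* register of n qubits: computational basis = bit strings of length n *)
Notation Qreg n := {ffun 'I_n -> bool}.

Section Quantum.
Variable R : realType.
Local Notation C := R[i].

Definition Op (T : finType) := T -> T -> C.
Definition Vec (T : finType) := T -> C.

Definition opmul (T : finType) (A B : Op T) : Op T :=
  fun i j => \sum_k A i k * B k j.
Definition adj (T : finType) (A : Op T) : Op T := fun i j => (A j i)^*.
Definition optr (T : finType) (A : Op T) : C := \sum_i A i i.
Definition opid (T : finType) : Op T := fun i j => (i == j)%:R.
Definition hermitian (T : finType) (A : Op T) := forall i j, A j i = (A i j)^*.
Definition psd (T : finType) (A : Op T) :=
  hermitian A /\ forall v : Vec T, 0 <= \sum_i \sum_j (v i)^* * A i j * v j.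
Definition is_state (T : finType) (A : Op T) := psd A /\ optr A = 1.
Definition vnorm2 (T : finType) (v : Vec T) : C := \sum_i (v i)^* * v i.
Definition ketbra (T : finType) (v : Vec T) : Op T := fun i j => v i * (v j)^*.

(* the positive semidefinite square root (unique for psd A) *)
Definition sqrtm (T : finType) (A : Op T) : Op T :=
  epsilon (inhabits (fun _ _ => 0)) (fun S : Op T => psd S /\ opmul S S = A).
Definition trnorm (T : finType) (A : Op T) : C := optr (sqrtm (opmul (adj A) A)).

Definition optens (T U : finType) (A : Op T) (B : Op U) : Op (T * U)%type :=
  fun p q => A p.1 q.1 * B p.2 q.2.
Definition ptr1 (T U : finType) (X : Op (T * U)%type) : Op U :=
  fun i j => \sum_t X (t, i) (t, j).
Definition ptr2 (T U : finType) (X : Op (T * U)%type) : Op T :=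
  fun i j => \sum_u X (i, u) (j, u).
Definition oppull (T U : finType) (f : T -> U) (X : Op U) : Op T :=
  fun i j => X (f i) (f j).
Definition unitop (T : finType) (a b : T) : Op T :=
  fun i j => ((i == a) && (j == b))%:R.

Definition linear_map (T U : finType) (Phi : Op T -> Op U) :=
  forall (c : C) (A B : Op T),
    Phi (fun i j => c * A i j + B i j) = (fun i j => c * Phi A i j + Phi B i j).
Definition idtens (T U W : finType) (Phi : Op T -> Op U) : Op (T * W)%type -> Op (U * W)%type :=
  fun X p q => Phi (fun i j => X (i, p.2) (j, q.2)) p.1 q.1.
Arguments idtens {T U} W Phi.
Definition cptp (T U : finType) (Phi : Op T -> Op U) :=
  [/\ linear_map Phi,
      (forall (W : finType) (X : Op (T * W)%type), psd X -> psd (idtens W Phi X)) &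
      (forall X : Op T, optr (Phi X) = optr X)].
(* tensor product (x)_i L_i of a family of linear maps, defined as the
   linear extension of its action on matrix units *)
Definition tensmaps (I : finType) (A B : I -> finType)
    (L : forall i, Op (A i) -> Op (B i)) :
    Op {dffun forall i, A i} -> Op {dffun forall i, B i} :=
  fun X y y' => \sum_a \sum_a' X a a' * \prod_i L i (unitop (a i) (a' i)) (y i) (y' i).

(* canonical purification  |sigma>_{M hatM} = (sqrt sigma (x) I) sum_j |j>|j> *)
Definition purif (T : finType) (s : Op T) : Op (T * T)%type :=
  ketbra (fun p : (T * T)%type => sqrtm s p.1 p.2).
Definition hat_marg (T : finType) (s : Op T) : Op T := ptr1 (purif s).
(* output space H_M (+) span{bot}; None stands for bot *)
Definition emb1 (T U : finType) (A : Op (T * U)%type) : Op (option T * U)%type :=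
  fun p q => match p.1, q.1 with
             | Some i, Some j => A (i, p.2) (j, q.2)
             | _, _ => 0 end.
Definition botop (T : finType) : Op (option T) :=
  fun o o' => ((o == None) && (o' == None))%:R.

Definition is_code (Mt I : finType) (X : I -> finType)
    (Enc : Op Mt -> Op {dffun forall i, X i})
    (Dec : Op {dffun forall i, X i} -> Op (option Mt)) :=
  [/\ cptp Enc, cptp Dec &
      forall s : Op Mt, is_state s ->
        idtens Mt Dec (idtens Mt Enc (purif s)) = emb1 (purif s)].

(* valid adversary of LO_e : environment E_i of q_i <= e_i qubits,
   CPTP maps Lam_i : X_i E_i -> X_i E'_i, pure shared state psi *)
Definition LO_valid (I : finType) (X : I -> finType) (e : I -> nat)
    (q : I -> nat) (F : I -> finType)
    (Lam : forall i, Op (X i * Qreg (q i))%type -> Op (X i * F i)%type)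
    (psi : Vec {dffun forall i, Qreg (q i)}) :=
  [/\ forall i, (q i <= e i)%N, forall i, cptp (Lam i) & vnorm2 psi = 1].

Definition experiment (Mt I : finType) (X : I -> finType)
    (Enc : Op Mt -> Op {dffun forall i, X i})
    (Dec : Op {dffun forall i, X i} -> Op (option Mt))
    (q : I -> nat) (F : I -> finType)
    (Lam : forall i, Op (X i * Qreg (q i))%type -> Op (X i * F i)%type)
    (psi : Vec {dffun forall i, Qreg (q i)}) (s : Op Mt) :
    Op ((option Mt * {dffun forall i, F i}) * Mt)%type :=
  let rho1 : Op ({dffun forall i, X i} * Mt)%type := idtens Mt Enc (purif s) in
  let rho2 : Op ({dffun forall i, X i * Qreg (q i)} * Mt)%type :=
    fun z z' =>
      rho1 ([ffun i => (z.1 i).1], z.2) ([ffun i => (z'.1 i).1], z'.2) *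
      ketbra psi [ffun i => (z.1 i).2] [ffun i => (z'.1 i).2] in
  let rho3 : Op ({dffun forall i, X i * F i} * Mt)%type :=
    idtens Mt (tensmaps Lam) rho2 in
  let rho4 : Op ({dffun forall i, X i} * ({dffun forall i, F i} * Mt))%type :=
    fun p p' => rho3 ([ffun i => (p.1 i, p.2.1 i)], p.2.2)
                     ([ffun i => (p'.1 i, p'.2.1 i)], p'.2.2) in
  let rho5 := idtens ({dffun forall i, F i} * Mt)%type Dec rho4 in
  fun r r' => rho5 (r.1.1, (r.1.2, r.2)) (r'.1.1, (r'.1.2, r'.2)).

Definition eta_MM (Mt : finType) (I : finType) (F : I -> finType)
    (out : Op ((option Mt * {dffun forall i, F i}) * Mt)%type) : Op (option Mt * Mt)%type :=
  fun r r' => \sum_f out ((r.1, f), r.2) ((r'.1, f), r'.2).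
Definition eta_MME (Mt : finType) (I : finType) (F : I -> finType) (i0 : I)
    (out : Op ((option Mt * {dffun forall i, F i}) * Mt)%type) :
    Op ((option Mt * Mt) * F i0)%type :=
  fun r r' => \sum_(f : {dffun forall i, F i} | f i0 == r.2)
     \sum_(f' : {dffun forall i, F i} | (f' i0 == r'.2) &&
                                          [forall j, (j != i0) ==> (f' j == f j)])
     out ((r.1.1, f), r.1.2) ((r'.1.1, f'), r'.1.2).
Arguments eta_MME {Mt I F} i0 out.

Definition nm_secure (Mt I : finType) (X : I -> finType)
    (Enc : Op Mt -> Op {dffun forall i, X i})
    (Dec : Op {dffun forall i, X i} -> Op (option Mt)) (e : I -> nat) (eps : R) :=
  forall (q : I -> nat) (F : I -> finType)
         (Lam : forall i, Op (X i * Qreg (q i))%type -> Op (X i * F i)%type)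
         (psi : Vec {dffun forall i, Qreg (q i)}),
  LO_valid e Lam psi ->
  exists (p : R) (gam : Op (option Mt)),
    [/\ 0 <= p <= 1, is_state gam &
      forall s : Op Mt, is_state s ->
        trnorm (fun r r' =>
          eta_MM (experiment Enc Dec Lam psi s) r r' -
          (p%:C * emb1 (purif s) r r'
           + (1 - p)%:C * (gam r.1 r'.1 * hat_marg s r.2 r'.2)))
        <= eps%:C].

Definition td_secure (Mt I : finType) (X : I -> finType)
    (Enc : Op Mt -> Op {dffun forall i, X i})
    (Dec : Op {dffun forall i, X i} -> Op (option Mt)) (e : I -> nat) (eps : R) :=
  forall (q : I -> nat) (F : I -> finType)
         (Lam : forall i, Op (X i * Qreg (q i))%type -> Op (X i * F i)%type)
         (psi : Vec {dffun forall i, Qreg (q i)}),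
  LO_valid e Lam psi ->
  exists p : R,
    0 <= p <= 1 /\
      forall s : Op Mt, is_state s ->
        trnorm (fun r r' =>
          eta_MM (experiment Enc Dec Lam psi s) r r' -
          (p%:C * emb1 (purif s) r r'
           + (1 - p)%:C * (@botop Mt r.1 r'.1 * hat_marg s r.2 r'.2)))
        <= eps%:C.

Definition aug_secure (Mt I : finType) (X : I -> finType)
    (Enc : Op Mt -> Op {dffun forall i, X i})
    (Dec : Op {dffun forall i, X i} -> Op (option Mt)) (e : I -> nat) (i0 : I)
    (eps : R) :=
  forall (q : I -> nat) (F : I -> finType)
         (Lam : forall i, Op (X i * Qreg (q i))%type -> Op (X i * F i)%type)
         (psi : Vec {dffun forall i, Qreg (q i)}),
  LO_valid e Lam psi ->
  exists (p : R) (zeta : Op (F i0)) (gam : Op (option Mt * F i0)%type),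
    [/\ 0 <= p <= 1, is_state zeta, is_state gam &
      forall s : Op Mt, is_state s ->
        trnorm (fun r r' =>
          eta_MME i0 (experiment Enc Dec Lam psi s) r r' -
          (p%:C * (emb1 (purif s) r.1 r'.1 * zeta r.2 r'.2)
           + (1 - p)%:C * (gam (r.1.1, r.2) (r'.1.1, r'.2) * hat_marg s r.1.2 r'.1.2)))
        <= eps%:C].

(* k qubits = first (k - l) qubits (register M) followed by l qubits (register E) *)
Definition qsplit (k l : nat) (H : (l <= k)%N) (x : Qreg k) : (Qreg (k - l) * Qreg l)%type :=
  ([ffun j : 'I_(k - l) => x (cast_ord (subnK H) (lshift l j))],
   [ffun j : 'I_l => x (cast_ord (subnK H) (rshift (k - l) j))]).
(* Phi^{(x) l} on E hatE (qubit j of E paired with qubit j of hatE) *)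
Definition epr (l : nat) : Op (Qreg l * Qreg l)%type :=
  fun p p' => ((p.1 == p.2) && (p'.1 == p'.2))%:R / 2 ^+ l.

(* t+1 shares indexed by option 'I_t : Some i = share i+1, None = share t+1 *)
Definition ext_ns (t : nat) (ns : 'I_t -> nat) (l : nat) (o : option 'I_t) : nat :=
  match o with Some i => ns i | None => l end.
Definition ext_e (t : nat) (e : 'I_t -> nat) (i0 : 'I_t) (a : nat)
    (o : option 'I_t) : nat :=
  match o with Some i => if i == i0 then (e i - a)%N else e i | None => a end.

Definition sh_split (t : nat) (ns : 'I_t -> nat) (l : nat)
    (y : {dffun forall o, Qreg (ext_ns ns l o)}) :
    ({dffun forall i, Qreg (ns i)} * Qreg l)%type :=
  ([ffun i => y (Some i)], y None).
Definition sh_join (t : nat) (ns : 'I_t -> nat) (l : nat)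
    (p : ({dffun forall i, Qreg (ns i)} * Qreg l)%type) :
    {dffun forall o, Qreg (ext_ns ns l o)} :=
  [ffun o => match o as o' return Qreg (ext_ns ns l o') with
             | Some i => p.1 i | None => p.2 end].

Definition newEnc (k l : nat) (H : (l <= k)%N) (t : nat) (ns : 'I_t -> nat)
    (Enc : Op (Qreg k) -> Op {dffun forall i, Qreg (ns i)})
    (s : Op (Qreg (k - l))) : Op {dffun forall o, Qreg (ext_ns ns l o)} :=
  let rho : Op (Qreg k * Qreg l)%type :=
    fun p p' => s (qsplit H p.1).1 (qsplit H p'.1).1 *
                epr ((qsplit H p.1).2, p.2) ((qsplit H p'.1).2, p'.2) in
  oppull (@sh_split t ns l) (idtens (Qreg l) Enc rho).

(* Dec: apply Dec^t to the first t shares (output M'E' or bot), measure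
   {P, I - P} with P = I_M (x) Phi^{(x) l}_{E' hatE} (P vanishes on bot),
   output M' on the first outcome and bot otherwise *)
Definition newDec (k l : nat) (H : (l <= k)%N) (t : nat) (ns : 'I_t -> nat)
    (Dec : Op {dffun forall i, Qreg (ns i)} -> Op (option (Qreg k)))
    (Y : Op {dffun forall o, Qreg (ext_ns ns l o)}) : Op (option (Qreg (k - l))) :=
  let rho : Op (option (Qreg k) * Qreg l)%type :=
    idtens (Qreg l) Dec (oppull (@sh_join t ns l) Y) in
  let P : Op (option (Qreg k) * Qreg l)%type :=
    fun p p' => match p.1, p'.1 with
                | Some x, Some x' =>
                    ((qsplit H x).1 == (qsplit H x').1)%:R *
                    epr ((qsplit H x).2, p.2) ((qsplit H x').2, p'.2)
                | _, _ => 0 end in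
  let PrP := opmul P (opmul rho P) in
  fun o o' => match o, o' with
    | Some m, Some m' =>
        \sum_x \sum_x' \sum_eh
          if [&& (qsplit H x).1 == m, (qsplit H x').1 == m'
               & (qsplit H x).2 == (qsplit H x').2]
          then PrP (Some x, eh) (Some x', eh) else 0
    | None, None => optr rho - optr (opmul P rho)
    | _, _ => 0 end.

End Quantum.

(* Main.v *)
Require Import Defs.
From HB Require Import structures.
From mathcomp Require Import all_boot all_order all_algebra.
From mathcomp Require Import reals complex ring.
From Stdlib Require Import ClassicalEpsilon FunctionalExtensionality.
Set Implicit Arguments.
Unset Strict Implicit.
Unset Printing Implicit Defensive.
Import Order.TTheory GRing.Theory Num.Theory.
Local Open Scope ring_scope.

(* An adversary on t+1 shares whose last share carries q <= a qubits of
   entanglement becomes an adversary on t shares by handing those q qubits,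
   untouched, to share 1 and keeping them in its output register. Augmented
   security for the padded message s (x) I/2^l (whose canonical purification is
   purif s (x) Phi) says that the state on M' M^ and the environment of share 1 is
   eps-close to a mixture of "same" and "fresh". Running the last tampering map
   and the EPR check on it is a channel that yields exactly the state of the new
   experiment, so the error stays eps. On the "same" part this channel
   produces the message with the entanglement fidelity f of the last tampering
   map, and bot otherwise. On the "fresh" part the check passes with probability
   2^-l tr(g J), where g is a sub-normalized state and J, a Choi matrix of the last
   tampering map, has trace 2^q; as tr(g J) <= tr g tr J, this is at most
   2^(a-l), which costs 2 * 2^(a-l) in trace norm. *)

(** * Spectral theorem *)

(** The reduction works because the reference register of the padded message is M^ together with
    hatE: the new last share is already present in the old experiment, as a part of the reference.
    The old decoder never acts on hatE, so the last tampering map can be postponed until after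
    decoding, provided the qubits it shares with the other parties survive; the augmented register
    is where they are kept. These qubits may be correlated with the decoded E'. So although hatE is
    uniform in the fresh part, the tampered hatE and E' need not be independent, and this possible
    correlation is what raises the bound from 2^-l to 2^(q-l). The factor 2 appears because the
    passing weight is removed from the message outcomes and put on bot, each change being paid once
    in trace norm. Trace norms are controlled by writing Hermitian operators as differences of
    positive ones, which yields the triangle inequality and contractivity under channels
    together. *)

Section Operators.
Variable R : realType.
Local Notation C := R[i].
Local Notation Op := (Op R).
Implicit Types T U : finType.

Lemma opP T U (f g : T -> U -> C) : (forall i j, f i j = g i j) -> f = g.
Proof. by move=> fg; apply: functional_extensionality => i; apply: functional_extensionality. Qed.

(* In Defs the notation ^* denotes conjc in some places and Num.conj in others,
   depending on the scope; the two are convertible. *)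
Lemma conjcE (x : C) : conjc x = x^*. Proof. by []. Qed.

Lemma hermP T (A : Op T) : Defs.hermitian A <-> forall i j, A j i = (A i j)^*.
Proof. by []. Qed.

Lemma conj_nneg (x : C) : 0 <= x -> x^* = x.
Proof. by move=> /ger0_real/CrealP. Qed.

Lemma sum_only T (i : T) (F : T -> C) :
  (forall j, j != i -> F j = 0) -> \sum_j F j = F i.
Proof. by move=> F0; rewrite (bigD1 i) //= big1 ?addr0. Qed.

Lemma sum_delta T (i : T) (F : T -> C) : \sum_j (i == j)%:R * F j = F i.
Proof.
rewrite (bigD1 i) //= eqxx mul1r big1 ?addr0 // => j.
by rewrite eq_sym => /negPf->; rewrite mul0r.
Qed.

Lemma sum_delta_r T (i : T) (F : T -> C) : \sum_j F j * (j == i)%:R = F i.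
Proof. by rewrite -[RHS](sum_delta i); apply: eq_bigr => j _; rewrite mulrC eq_sym. Qed.

Lemma reindex_can T U (f : U -> T) (g : T -> U) (F : T -> C) :
  cancel f g -> cancel g f -> \sum_i F i = \sum_j F (f j).
Proof. by move=> fK gK; rewrite (reindex f) //; exists g => i _; [apply: fK | apply: gK]. Qed.

Lemma pair_sum T U (F : T * U -> C) : \sum_p F p = \sum_i \sum_j F (i, j).
Proof. by rewrite pair_big; apply: eq_bigr => -[]. Qed.

Definition dotp T (u v : T -> C) := \sum_j (u j)^* * v j.
Definition qform T (A : Op T) (v : T -> C) := \sum_i \sum_j (v i)^* * A i j * v j.
(** The operator sum_k d_k |w_k><w_k|. With [onb w] it is a spectral decomposition; with arbitrary
    vectors and nonnegative weights it is the working form of a positive operator. *)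
Definition gram T (K : finType) (d : K -> C) (w : K -> T -> C) : Op T :=
  fun i j => \sum_k d k * (w k i * (w k j)^*).
Definition onb T (u : T -> T -> C) :=
  (forall k l, \sum_i u k i * (u l i)^* = (k == l)%:R) /\
  (forall i j, \sum_k u k i * (u k j)^* = (i == j)%:R).

Lemma dotp_conj T (u v : T -> C) : (dotp u v)^* = dotp v u.
Proof. by rewrite /dotp rmorph_sum; apply: eq_bigr => i _; rewrite rmorphM /= conjCK mulrC. Qed.

Lemma qform_gram T (K : finType) (d : K -> C) (w : K -> T -> C) v :
  qform (gram d w) v = \sum_k d k * (dotp (w k) v * (dotp (w k) v)^*).
Proof.
transitivity (\sum_k \sum_i \sum_j (v i)^* * (d k * (w k i * (w k j)^*)) * v j).
  rewrite exchange_big; apply: eq_bigr => i _.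
  rewrite exchange_big; apply: eq_bigr => j _.
  by rewrite /gram big_distrr big_distrl.
apply: eq_bigr => k _; rewrite dotp_conj [dotp _ v * _]mulrC.
rewrite /dotp big_distrl big_distrr; apply: eq_bigr => i _ /=.
rewrite 2!big_distrr; apply: eq_bigr => j _ /=.
by ring.
Qed.

Lemma mulconj_ge0 (x : C) : 0 <= x * x^*.
Proof. exact: mul_conjC_ge0. Qed.

Lemma gram_hermitian T (K : finType) (d : K -> C) (w : K -> T -> C) :
  (forall k, (d k)^* = d k) -> Defs.hermitian (gram d w).
Proof.
move=> dR; apply/hermP => i j; rewrite /gram rmorph_sum; apply: eq_bigr => k _.
by rewrite !rmorphM /= dR conjCK [w k j * _]mulrC.
Qed.

Lemma psd_gram T (K : finType) (d : K -> C) (w : K -> T -> C) :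
  (forall k, 0 <= d k) -> psd (gram d w).
Proof.
move=> d0; split; first by apply: gram_hermitian => k; apply: conj_nneg.
move=> v; rewrite -/(qform _ _) qform_gram; apply: sumr_ge0 => k _.
by rewrite mulr_ge0 ?mulconj_ge0.
Qed.

Lemma spectral T (A : Op T) : Defs.hermitian A ->
  exists (u : T -> T -> C) (d : T -> C),
    [/\ onb u, forall k, (d k)^* = d k & A = gram d u].
Proof.
move=> hA; pose n := #|T|.
pose M : 'M[C]_n := \matrix_(i, j) A (enum_val i) (enum_val j).
have hM : M \is hermsymmx.
  apply/is_hermitianmxP; rewrite expr0 scale1r; apply/matrixP => i j.
  by rewrite !mxE hA.
have /orthomx_spectralP ME := hermitian_normalmx hM.
have dR := hermitian_spectral_diag_real hM.
have PU := spectral_unitarymx M.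
move: (spectralmx M) (spectral_diag M) ME dR PU => P D ME dR PU.
rewrite (invmx_unitary PU) in ME.
have /unitarymxP P1 := PU.
have P2 : map_mx Num.conj P^T *m P = 1%:M by apply: mulmx1C.
(* The matrix is P^dagger D P, so the eigenvectors are the conjugated rows of P. *)
pose u k i : C := (P (enum_rank k) (enum_rank i))^*.
pose d k : C := D 0 (enum_rank k).
have rei (F : 'I_n -> C) : \sum_i F i = \sum_(k : T) F (enum_rank k).
  by apply: reindex_can; [apply: enum_rankK | apply: enum_valK].
exists u, d; split.
- split=> k l.
    have /matrixP/(_ (enum_rank l) (enum_rank k)) := P1.
    rewrite !mxE rei (inj_eq enum_rank_inj) eq_sym => <-; apply: eq_bigr => i _.
    by rewrite !mxE /u conjCK mulrC.
  have /matrixP/(_ (enum_rank k) (enum_rank l)) := P2.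
  rewrite !mxE rei (inj_eq enum_rank_inj) => <-; apply: eq_bigr => i _.
  by rewrite !mxE /u /d conjCK.
- by move=> k; have /mxOverP/(_ 0 (enum_rank k))/CrealP := dR.
- apply: opP => i j.
  have /matrixP/(_ (enum_rank i) (enum_rank j)) := ME.
  rewrite !mxE !enum_rankK => ->; rewrite rei /gram; apply: eq_bigr => k _.
  rewrite mul_mx_diag !mxE /u /d conjCK.
  by ring.
Qed.
End Operators.

(** * Positive semidefinite operators *)

Section Psd.
Variable R : realType.
Local Notation C := R[i].
Local Notation Op := (Op R).
Implicit Types T U : finType.

Lemma qform_eig T (d : T -> C) (u : T -> T -> C) k : onb u ->
  qform (gram d u) (u k) = d k.
Proof.
move=> [u1 _]; rewrite qform_gram.
have dE l : dotp (u l) (u k) = (k == l)%:R.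
  by rewrite -u1; apply: eq_bigr => i _; rewrite mulrC.
rewrite (bigD1 k) //= dE eqxx mulr1n rmorph1 !mulr1 big1 ?addr0 // => l.
by rewrite dE eq_sym => /negPf->; rewrite mul0r mulr0.
Qed.

Lemma psd_spectral T (A : Op T) : psd A ->
  exists (u : T -> T -> C) (d : T -> C),
    [/\ onb u, forall k, 0 <= d k & A = gram d u].
Proof.
move=> [hA pA]; have [u [d [ou dR AE]]] := spectral hA.
exists u, d; split=> // k; rewrite -(qform_eig d k ou) -AE; exact: pA.
Qed.

(** Absorbing the square roots of the eigenvalues into the eigenvectors gives up orthogonality, but
    pullbacks, blocks and entrywise products of positive operators then become computations on
    vectors. *)
Lemma psd_outer T (A : Op T) : psd A ->
  exists w : T -> T -> C, A = gram (fun=> 1) w.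
Proof.
move=> /psd_spectral[u [d [_ d0 ->]]].
exists (fun k i => sqrtC (d k) * u k i); apply: opP => i j; apply: eq_bigr => k _.
have s0 : (sqrtC (d k))^* = sqrtC (d k) by apply: conj_nneg; rewrite sqrtC_ge0.
rewrite rmorphM /= s0 mul1r mulrACA -expr2 sqrtCK.
by [].
Qed.

Lemma psd_ext T (A B : Op T) : (forall i j, A i j = B i j) -> psd A -> psd B.
Proof. by move=> /opP->. Qed.

Lemma psd_diag_ge0 T (A : Op T) i : psd A -> 0 <= A i i.
Proof.
move=> /psd_outer[w ->]; apply: sumr_ge0 => k _; rewrite mul1r; exact: mulconj_ge0.
Qed.

Lemma psd_tr_ge0 T (A : Op T) : psd A -> 0 <= optr A.
Proof. by move=> pA; apply: sumr_ge0 => i _; apply: psd_diag_ge0. Qed.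

Lemma psd_sum T (K : finType) (P : pred K) (A : K -> Op T) :
  (forall k, psd (A k)) -> psd (fun i j => \sum_(k | P k) A k i j).
Proof.
move=> pA; split.
  apply/hermP => i j; rewrite rmorph_sum; apply: eq_bigr => k _.
  by case: (pA k) => /hermP h _; rewrite h.
move=> v; under eq_bigr => i _ do under eq_bigr => j _ do rewrite mulr_sumr mulr_suml.
under eq_bigr => i _ do rewrite exchange_big.
by rewrite exchange_big; apply: sumr_ge0 => k _; case: (pA k) => _ /(_ v).
Qed.

Lemma psd_add T (A B : Op T) : psd A -> psd B -> psd (fun i j => A i j + B i j).
Proof.
move=> pA pB; apply: (@psd_ext _ (fun i j => \sum_(b : bool) (if b then A else B) i j)).
  by move=> i j; rewrite big_bool.
by apply: (@psd_sum _ _ predT (fun b : bool => if b then A else B)) => -[].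
Qed.

Lemma psd_scale T (c : C) (A : Op T) : 0 <= c -> psd A -> psd (fun i j => c * A i j).
Proof.
move=> c0 /psd_outer[w ->].
apply: (@psd_ext _ (gram (fun=> c) w)); last exact: psd_gram.
by move=> i j; rewrite /gram mulr_sumr; apply: eq_bigr => k _; rewrite mul1r.
Qed.

Lemma psd_oppull T U (f : T -> U) (A : Op U) : psd A -> psd (oppull f A).
Proof.
move=> /psd_outer[w ->].
by apply: (@psd_gram _ _ _ (fun=> 1) (fun k i => w k (f i))) => k; apply: ler01.
Qed.

(** Schur product theorem: the entrywise products of the generating vectors generate the product.
    Tensor products are later obtained as Schur products of pullbacks along projections. *)
Lemma psd_mul T (A B : Op T) : psd A -> psd B -> psd (fun i j => A i j * B i j).
Proof.
move=> /psd_outer[v ->] /psd_outer[w ->].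
apply: (@psd_ext _ (gram (fun=> 1) (fun (k : T * T) i => v k.1 i * w k.2 i))).
  move=> i j; rewrite /gram pair_sum big_distrl; apply: eq_bigr => k _ /=.
  rewrite big_distrr; apply: eq_bigr => l _ /=; rewrite rmorphM /=; ring.
by apply: psd_gram => k; apply: ler01.
Qed.

Lemma psd_rank1 T (v : T -> C) : psd (fun i j => v i * (v j)^*).
Proof.
apply: (@psd_ext _ (gram (fun=> 1) (fun (_ : unit) => v))).
  by move=> i j; rewrite /gram big_const card_unit /= mul1r addr0.
by apply: psd_gram => k; apply: ler01.
Qed.

Lemma psd_opid T : psd (@opid R T).
Proof.
apply: (@psd_ext _ (gram (fun=> 1) (fun k i => (k == i)%:R))); last first.
  by apply: psd_gram => k; apply: ler01.
move=> i j; rewrite /gram /opid -[RHS](sum_delta i (fun k => (k == j)%:R)).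
by apply: eq_bigr => k _; rewrite mul1r conjC_nat eq_sym.
Qed.

Lemma optr_gram T (d : T -> C) (u : T -> T -> C) : onb u ->
  optr (gram d u) = \sum_k d k.
Proof.
move=> [u1 _]; rewrite /optr /gram exchange_big; apply: eq_bigr => k _ /=.
by rewrite -mulr_sumr u1 eqxx mulr1.
Qed.

Lemma parseval T (u : T -> T -> C) (v : T -> C) : onb u ->
  \sum_k dotp (u k) v * (dotp (u k) v)^* = \sum_i v i * (v i)^*.
Proof.
move=> [_ u2]; have := qform_gram (fun=> 1) u v.
under [in X in _ = X]eq_bigr => k _ do rewrite mul1r.
move=> <-; rewrite /qform; apply: eq_bigr => i _.
rewrite -[RHS](sum_delta i (fun j => v j * (v i)^*)); apply: eq_bigr => j _.
have -> : gram (fun=> 1) u i j = (i == j)%:R.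
  by rewrite -u2; apply: eq_bigr => k _; rewrite mul1r.
by ring.
Qed.

(** The left side is tr(A B^T). In an eigenbasis of A it is a sum of quadratic forms of B at
    conjugated unit vectors, and each form is at most the sum of the eigenvalues of B, since every
    single eigenvalue is. *)
Lemma optr_mul_le T (A B : Op T) : psd A -> psd B ->
  \sum_i \sum_j A i j * B i j <= optr A * optr B.
Proof.
move=> /psd_spectral[u [d [ou d0 ->]]] /psd_spectral[v [f [ov f0 ->]]].
rewrite !optr_gram // mulr_suml.
have -> : \sum_i \sum_j gram d u i j * gram f v i j =
    \sum_k d k * qform (gram f v) (fun i => (u k i)^*).
  under [RHS]eq_bigr => k _ do rewrite mulr_sumr.
  rewrite [RHS]exchange_big; apply: eq_bigr => i _.
  under [RHS]eq_bigr => k _ do rewrite mulr_sumr.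
  rewrite [RHS]exchange_big; apply: eq_bigr => j _ /=.
  rewrite /gram mulr_suml; apply: eq_bigr => k _ /=.
  by rewrite conjCK; ring.
apply: ler_sum => k _; apply: ler_wpM2l => //; rewrite qform_gram.
apply: (@le_trans _ _ (\sum_l (\sum_m f m) *
   (dotp (v l) (fun i => (u k i)^*) * (dotp (v l) (fun i => (u k i)^*))^*))).
  apply: ler_sum => l _; apply: ler_wpM2r; first exact: mulconj_ge0.
  by rewrite (bigD1 l) //= lerDl; apply: sumr_ge0 => m _; apply: f0.
rewrite -mulr_sumr parseval //.
suff -> : \sum_i (u k i)^* * ((u k i)^*)^* = 1 by rewrite mulr1.
case: ou => /(_ k k) + _; rewrite eqxx mulr1n => <-.
by apply: eq_bigr => i _; rewrite conjCK mulrC.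
Qed.

End Psd.

(** * Square root and trace norm *)

Section TraceNorm.
Variable R : realType.
Local Notation C := R[i].
Local Notation Op := (Op R).
Implicit Types T U : finType.

Lemma dotp_gram T (d : T -> C) (u : T -> T -> C) (v : T -> C) k : onb u ->
  \sum_i \sum_j (u k i)^* * gram d u i j * v j = d k * dotp (u k) v.
Proof.
move=> [u1 _].
transitivity (\sum_l d l * dotp (u l) v * \sum_i u l i * (u k i)^*).
  under [RHS]eq_bigr => l _ do rewrite mulr_sumr.
  rewrite [RHS]exchange_big; apply: eq_bigr => i _.
  under [RHS]eq_bigr => l _ do rewrite mulr_sumr mulr_suml.
  rewrite [RHS]exchange_big; apply: eq_bigr => j _ /=.
  rewrite /gram mulr_sumr mulr_suml; apply: eq_bigr => l _ /=; ring.
under eq_bigr => l _ do rewrite u1.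
exact: sum_delta_r.
Qed.

Lemma gram_dotp T (f : T -> C) (v : T -> T -> C) (u : T -> C) l : onb v ->
  \sum_i \sum_j (u i)^* * gram f v i j * v l j = dotp u (v l) * f l.
Proof.
move=> [v1 _].
transitivity (\sum_k f k * dotp u (v k) * \sum_j v l j * (v k j)^*).
  under [RHS]eq_bigr => k _ do rewrite mulr_sumr.
  rewrite [LHS]exchange_big [RHS]exchange_big; apply: eq_bigr => j _ /=.
  under [RHS]eq_bigr => k _ do rewrite mulr_sumr mulr_suml.
  rewrite [RHS]exchange_big; apply: eq_bigr => i _ /=.
  rewrite /gram mulr_sumr mulr_suml; apply: eq_bigr => k _ /=; ring.
under eq_bigr => k _ do rewrite v1 eq_sym.
by rewrite sum_delta_r mulrC.
Qed.

(** Inserting the completeness relation of [v] gives coordinates with respect to |u_k><v_l|.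
    Together with [gram_expandl] this compares two operators that have different eigenbases. *)
Lemma gram_expandr T (d : T -> C) (u v : T -> T -> C) i j : onb v ->
  gram d u i j = \sum_k \sum_l u k i * (d k * dotp (u k) (v l)) * (v l j)^*.
Proof.
move=> [_ v2]; apply: eq_bigr => k _.
transitivity (\sum_m u k i * d k * (u k m)^* * \sum_l v l m * (v l j)^*).
  under [RHS]eq_bigr => m _ do rewrite v2.
  rewrite sum_delta_r /=; ring.
under eq_bigr => m _ do rewrite mulr_sumr.
rewrite exchange_big; apply: eq_bigr => l _.
rewrite 2!mulr_sumr mulr_suml; apply: eq_bigr => m _ /=; ring.
Qed.

Lemma gram_expandl T (f : T -> C) (u v : T -> T -> C) i j : onb u ->
  gram f v i j = \sum_k \sum_l u k i * (dotp (u k) (v l) * f l) * (v l j)^*.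
Proof.
move=> [_ u2]; rewrite exchange_big; apply: eq_bigr => l _.
transitivity (\sum_m v l m * f l * (v l j)^* * \sum_k u k i * (u k m)^*).
  under [RHS]eq_bigr => m _ do rewrite u2 eq_sym.
  rewrite sum_delta_r /=; ring.
under [LHS]eq_bigr => m _ do rewrite mulr_sumr.
rewrite [LHS]exchange_big; apply: eq_bigr => k _.
rewrite /dotp mulr_suml mulr_sumr mulr_suml; apply: eq_bigr => m _ /=; ring.
Qed.

Lemma opmul_gram T (d : T -> C) (u : T -> T -> C) : onb u ->
  opmul (gram d u) (gram d u) = gram (fun k => d k * d k) u.
Proof.
move=> [u1 _]; apply: opP => i j; rewrite /opmul.
transitivity (\sum_k \sum_l d k * d l * u k i * (u l j)^* * \sum_m u l m * (u k m)^*).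
  under [RHS]eq_bigr => k _ do under eq_bigr => l _ do rewrite mulr_sumr.
  under [RHS]eq_bigr => k _ do rewrite exchange_big.
  rewrite [RHS]exchange_big; apply: eq_bigr => m _ /=.
  rewrite /gram big_distrlr; apply: eq_bigr => k _; apply: eq_bigr => l _ /=; ring.
apply: eq_bigr => k _; under eq_bigr => l _ do rewrite u1.
rewrite sum_delta_r /=; ring.
Qed.

(** In mixed coordinates the equality of squares reads d_k^2 <u_k,v_l> = <u_k,v_l> f_l^2. Where the
    overlap is nonzero, nonnegativity gives d_k = f_l; where it vanishes, both entries are 0. *)
Lemma sqrt_unique T (S S' : Op T) : psd S -> psd S' ->
  opmul S S = opmul S' S' -> S = S'.
Proof.
move=> /psd_spectral[u [d [ou d0 ->]]] /psd_spectral[v [f [ov f0 ->]]].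
rewrite !opmul_gram // => E; apply: opP => i j.
rewrite (gram_expandr d u i j ov) (gram_expandl f v i j ou).
apply: eq_bigr => k _; apply: eq_bigr => l _; congr (_ * _ * _).
have := dotp_gram (fun k => d k * d k) (v l) k ou.
rewrite E gram_dotp // => H.
have [/eqP c0|c0] := boolP (dotp (u k) (v l) == 0); first by rewrite c0 mulr0 mul0r.
rewrite mulrC; congr (_ * _).
have {}H : d k ^+ 2 = f l ^+ 2 by apply: (mulfI c0); rewrite !expr2 H mulrC.
by apply/eqP; rewrite -(eqrXn2 (ltn0Sn 1)) ?H.
Qed.

Lemma sqrtm_psd_sqr T (A : Op T) : psd A -> psd (sqrtm A) /\ opmul (sqrtm A) (sqrtm A) = A.
Proof.
move=> /psd_spectral[u [d [ou d0 ->]]].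
apply: (epsilon_spec (inhabits (fun _ _ => 0))
  (fun S : Op T => psd S /\ opmul S S = gram d u)).
exists (gram (fun k => sqrtC (d k)) u); split.
  by apply: psd_gram => k; rewrite sqrtC_ge0.
rewrite opmul_gram //; apply: opP => i j; apply: eq_bigr => k _.
by rewrite -expr2 sqrtCK.
Qed.

(** [sqrtm] is picked by [epsilon]; uniqueness of the positive root is what lets it be computed. *)
Lemma sqrtmE T (A S : Op T) : psd S -> opmul S S = A -> sqrtm A = S.
Proof.
move=> pS SA.
suff [pQ QA] : psd (sqrtm A) /\ opmul (sqrtm A) (sqrtm A) = A.
  by apply: sqrt_unique => //; rewrite QA.
apply: (epsilon_spec (inhabits (fun _ _ => 0))
  (fun S : Op T => psd S /\ opmul S S = A)).
by exists S.
Qed.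

Lemma trnorm_gram T (d : T -> C) (u : T -> T -> C) : onb u ->
  (forall k, (d k)^* = d k) -> trnorm (gram d u) = \sum_k `|d k|.
Proof.
move=> ou dR; rewrite /trnorm.
have -> : adj (gram d u) = gram d u.
  apply: opP => i j; rewrite /adj conjcE.
  by have /hermP-> := gram_hermitian u dR; rewrite conjCK.
rewrite opmul_gram // (@sqrtmE _ _ (gram (fun k => `|d k|) u)) ?optr_gram //.
  exact: psd_gram.
rewrite opmul_gram //; apply: opP => i j; apply: eq_bigr => k _.
by rewrite -!expr2 real_normK //; apply/CrealP.
Qed.

(** Jordan decomposition: the two parts carry the weights (|d| + d)/2 and (|d| - d)/2 on the same
    eigenbasis. *)
Lemma trnorm_split T (A : Op T) : Defs.hermitian A ->
  exists P N : Op T, [/\ psd P, psd N, A = (fun i j => P i j - N i j) &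
    trnorm A = optr P + optr N].
Proof.
move=> /spectral[u [d [ou dR ->]]].
have dr k : d k \is Num.real by apply/CrealP.
exists (gram (fun k => (`|d k| + d k) / 2) u), (gram (fun k => (`|d k| - d k) / 2) u).
split.
- apply: psd_gram => k; apply: divr_ge0; last by rewrite ler0n.
  by rewrite -lerBlDr sub0r -normrN real_ler_norm // realN.
- apply: psd_gram => k; apply: divr_ge0; last by rewrite ler0n.
  by rewrite subr_ge0 real_ler_norm.
- apply: opP => i j; rewrite -sumrB; apply: eq_bigr => k _; by field.
rewrite trnorm_gram // !optr_gram // -big_split; apply: eq_bigr => k _ /=; by field.
Qed.

Lemma sum_qform T (A : Op T) (u : T -> T -> C) : onb u ->
  \sum_k qform A (u k) = optr A.
Proof.
move=> [_ u2]; rewrite /qform exchange_big; apply: eq_bigr => i _.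
rewrite exchange_big /= -[RHS](sum_delta_r i (fun j => A i j)).
apply: eq_bigr => j _; rewrite -u2 mulr_sumr; apply: eq_bigr => k _; ring.
Qed.

(** Each eigenvalue of P - N is the difference of the quadratic forms of P and N at its eigenvector,
    and the forms sum to the traces. With [trnorm_split] this makes the trace norm the least total
    trace of such a decomposition. *)
Lemma trnorm_sub_le T (P N : Op T) : psd P -> psd N ->
  trnorm (fun i j => P i j - N i j) <= optr P + optr N.
Proof.
move=> pP pN; set A := fun i j => _.
have hA : Defs.hermitian A.
  apply/hermP => i j; rewrite /A rmorphB /=.
  by case: pP => /hermP-> _; case: pN => /hermP-> _.
have [u [d [ou dR AE]]] := spectral hA.
rewrite AE trnorm_gram // -(sum_qform P ou) -(sum_qform N ou) -big_split.
apply: ler_sum => k _ /=.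
have -> : d k = qform P (u k) - qform N (u k).
  rewrite -(qform_eig d k ou) -AE /qform -sumrB; apply: eq_bigr => i _.
  by rewrite -sumrB; apply: eq_bigr => j _; rewrite /A; ring.
have P0 : 0 <= qform P (u k) by case: pP => _; apply.
have N0 : 0 <= qform N (u k) by case: pN => _; apply.
by rewrite (le_trans (ler_normB _ _)) // !ger0_norm.
Qed.

End TraceNorm.

(** * Channels *)

Section Channels.
Variable R : realType.
Local Notation C := R[i].
Local Notation Op := (Op R).
Implicit Types T U V W K : finType.

Lemma psd_extend T U (g : U -> option T) (A : Op T) : psd A ->
  psd (fun p q => if g p is Some i then if g q is Some j then A i j else 0 else 0).
Proof.
move=> /psd_outer[w ->].
apply: (@psd_ext _ _ (gram (fun=> 1) (fun k p => oapp (w k) 0 (g p)))); last first.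
  by apply: psd_gram => k; apply: ler01.
move=> p q; rewrite /gram; case: (g p) => [i|]; last first.
  by rewrite big1 // => k _; rewrite mul0r mulr0.
case: (g q) => [j|] //=.
by rewrite big1 // => k _; rewrite rmorph0 !mulr0.
Qed.

Lemma op_units T (X : Op T) :
  X = fun i j => \sum_(p : T * T) X p.1 p.2 * unitop R p.1 p.2 i j.
Proof.
apply: opP => i j; rewrite pair_sum -[LHS](sum_delta i (fun i' => X i' j)).
apply: eq_bigr => i' _; rewrite -(sum_delta j (fun j' => X i' j')) mulr_sumr.
apply: eq_bigr => j' _; rewrite /unitop.
by case: (i == i'); case: (j == j'); rewrite ?(mul1r, mul0r, mulr0, mulr1).
Qed.

Section Linear.
Variables (T U : finType) (Phi : Op T -> Op U).
Hypothesis Phi_lin : linear_map Phi.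

Lemma lin_zero : Phi (fun _ _ => 0) = fun _ _ => 0.
Proof.
have := Phi_lin (-1) (fun _ _ => 0) (fun _ _ => 0).
have -> : (fun _ _ : T => -1 * 0 + 0) = (fun _ _ => 0) :> Op T.
  by apply: opP => i j; rewrite mulr0 addr0.
by move=> E; apply: opP => i j; rewrite E; ring.
Qed.

Lemma lin_scale c (A : Op T) :
  Phi (fun i j => c * A i j) = fun i j => c * Phi A i j.
Proof.
have -> : (fun i j => c * A i j) = (fun i j => c * A i j + 0) :> Op T.
  by apply: opP => i j; rewrite addr0.
by rewrite (Phi_lin c A (fun _ _ => 0)) lin_zero; apply: opP => i j; rewrite addr0.
Qed.

Lemma lin_add (A B : Op T) :
  Phi (fun i j => A i j + B i j) = fun i j => Phi A i j + Phi B i j.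
Proof.
have -> : (fun i j => A i j + B i j) = (fun i j => 1 * A i j + B i j) :> Op T.
  by apply: opP => i j; rewrite mul1r.
by rewrite (Phi_lin 1 A B); apply: opP => i j; rewrite mul1r.
Qed.

Lemma lin_sub (A B : Op T) :
  Phi (fun i j => A i j - B i j) = fun i j => Phi A i j - Phi B i j.
Proof.
have -> : (fun i j => A i j - B i j) = (fun i j => -1 * B i j + A i j) :> Op T.
  by apply: opP => i j; ring.
by rewrite (Phi_lin (-1) B A); apply: opP => i j; ring.
Qed.

Lemma lin_sum K (c : K -> C) (A : K -> Op T) :
  Phi (fun i j => \sum_k c k * A k i j) = fun i j => \sum_k c k * Phi (A k) i j.
Proof.
rewrite unlock /reducebig; elim: (index_enum K) => [|k s IH] /=; first exact: lin_zero.
by rewrite Phi_lin IH.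
Qed.

Lemma lin_units (X : Op T) y y' :
  Phi X y y' = \sum_a \sum_a' X a a' * Phi (unitop R a a') y y'.
Proof. by rewrite {1}(op_units X) lin_sum pair_sum. Qed.

Lemma lin_comp V (Psi : Op U -> Op V) : linear_map Psi ->
  linear_map (fun X => Psi (Phi X)).
Proof. by move=> Psi_lin c A B; rewrite Phi_lin Psi_lin. Qed.

Lemma lin_idtens W : linear_map (@idtens R T U W Phi).
Proof. by move=> c A B; apply: opP => p q; rewrite /idtens Phi_lin. Qed.

End Linear.

Lemma cptp_lin T U (Phi : Op T -> Op U) : cptp Phi -> linear_map Phi.
Proof. by case. Qed.

Lemma cptp_tr T U (Phi : Op T -> Op U) X : cptp Phi -> optr (Phi X) = optr X.
Proof. by case. Qed.

Lemma cptp_psd T U (Phi : Op T -> Op U) X : cptp Phi -> psd X -> psd (Phi X).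
Proof.
case=> _ /(_ unit) cp _ pX.
exact: (psd_oppull (fun i => (i, tt)) (cp _ (psd_oppull (@fst T unit) pX))).
Qed.

Lemma cptp_state T U (Phi : Op T -> Op U) X : cptp Phi -> is_state X -> is_state (Phi X).
Proof. by move=> cP [pX tX]; split; [apply: cptp_psd | rewrite cptp_tr]. Qed.

Lemma cptp_comp T U V (Phi : Op T -> Op U) (Psi : Op U -> Op V) :
  cptp Phi -> cptp Psi -> cptp (fun X => Psi (Phi X)).
Proof.
move=> [l1 p1 t1] [l2 p2 t2]; split; first exact: lin_comp.
- by move=> W X pX; apply: psd_ext (p2 W _ (p1 W X pX)) => i j.
- by move=> X; rewrite t2 t1.
Qed.

Lemma cptp_idtens T U W (Phi : Op T -> Op U) : cptp Phi -> cptp (@idtens R T U W Phi).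
Proof.
move=> [l p t]; split; first exact: lin_idtens.
- move=> W' X pX.
  have pX' := p (W * W')%type _
    (psd_oppull (fun z : T * (W * W') => ((z.1, z.2.1), z.2.2)) pX).
  exact: (psd_oppull (fun z : (U * W) * W' => (z.1.1, (z.1.2, z.2))) pX').
move=> X; rewrite /optr !pair_sum exchange_big /= [RHS]exchange_big /=.
by apply: eq_bigr => w _; have := t (fun i j => X (i, w) (j, w)).
Qed.

(* A partial trace over [K], up to an identification of [T] with [K * U]. *)
Lemma cptp_ptrace T U K (f : K -> U -> T) (g : T -> K * U) :
  (forall k u, g (f k u) = (k, u)) -> (forall t, f (g t).1 (g t).2 = t) ->
  cptp (fun (X : Op T) i j => \sum_k X (f k i) (f k j)).
Proof.
move=> fK gK; split.
- move=> c A B; apply: opP => i j; rewrite mulr_sumr -big_split.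
  by apply: eq_bigr.
- move=> W X pX.
  apply: (@psd_sum _ _ K predT
    (fun k => oppull (fun p : U * W => (f k p.1, p.2)) X)) => k.
  exact: psd_oppull.
move=> X; rewrite /optr exchange_big -(pair_sum (fun p => X (f p.1 p.2) (f p.1 p.2))).
by rewrite [RHS](reindex_can (f := fun p => f p.1 p.2) (g := g)) // => -[].
Qed.

Lemma cptp_oppull T U (f : T -> U) (g : U -> T) : cancel f g -> cancel g f ->
  cptp (@oppull R T U f).
Proof.
move=> fK gK.
have := @cptp_ptrace U T unit (fun _ => f) (fun u => (tt, g u)).
have -> : (fun (X : Op U) i j => \sum_(k : unit) X (f i) (f j)) = oppull f.
  apply: functional_extensionality => X; apply: opP => i j.
  by rewrite big_const card_unit /= addr0.
by apply=> // -[] u; rewrite fK.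
Qed.

Lemma cptp_herm T U (Phi : Op T -> Op U) X : cptp Phi ->
  Defs.hermitian X -> Defs.hermitian (Phi X).
Proof.
move=> cP /spectral[u [d [_ dR ->]]].
rewrite /gram (lin_sum (cptp_lin cP) d (fun k i j => u k i * (u k j)^*)).
apply/hermP => i j; rewrite rmorph_sum; apply: eq_bigr => k _.
rewrite rmorphM /= dR; congr (_ * _).
by case: (cptp_psd cP (psd_rank1 (u k))) => /hermP/(_ i j).
Qed.

(** Matrix units are not Hermitian, so Hermiticity preservation is applied to |a><a'| + |a'><a| and
    to i|a><a'| - i|a'><a|, and the two results are recombined. *)
Lemma cptp_unit_conj T U (Phi : Op T -> Op U) a a' y y' : cptp Phi ->
  (Phi (unitop R a a') y y')^* = Phi (unitop R a' a) y' y.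
Proof.
move=> cP; have l := cptp_lin cP.
have uC b b' i j : (unitop R b b' i j)^* = unitop R b' b j i.
  by rewrite /unitop conjC_nat andbC.
have h1 : Defs.hermitian (Phi (fun i j => unitop R a a' i j + unitop R a' a i j)).
  by apply: cptp_herm => //; apply/hermP => i j; rewrite rmorphD /= !uC addrC.
have h2 : Defs.hermitian (Phi (fun i j => 'i * unitop R a a' i j + (- 'i * unitop R a' a i j))).
  apply: cptp_herm => //; apply/hermP => i j.
  by rewrite rmorphD /= !rmorphM /= !uC rmorphN /= conjCi opprK addrC.
move: h1 h2; rewrite !lin_add // !(lin_scale l) => /hermP/(_ y y') h1 /hermP/(_ y y').
move: h1; rewrite !rmorphD /= !rmorphM /= rmorphN /= conjCi => h1 h2.
move: (Phi (unitop R a a') y y') (Phi (unitop R a' a) y' y) h1 h2 => p q.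
move: (Phi (unitop R a' a) y y') (Phi (unitop R a a') y' y) => x z h1 h2.
have {}h2 : z - q = - p^* + x^*.
  by apply: (mulfI (neq0Ci C)); rewrite mulrBr -mulNr h2; ring.
have : 2 * p^* = 2 * q.
  by rewrite [2 * q](_ : _ = (z + q) - (z - q)); [rewrite h1 h2|]; ring.
by apply: mulfI; rewrite pnatr_eq0.
Qed.

(** [tensmaps] is given by a formula on matrix units, so it commutes with the adjoint as soon as
    every factor does so on matrix units. *)
Lemma tensmaps_conj (I : finType) (A B : I -> finType)
    (L : forall i, Op (A i) -> Op (B i)) X y y' :
  (forall i, cptp (L i)) ->
  (tensmaps L X y y')^* = tensmaps L (fun a a' => (X a' a)^*) y' y.
Proof.
move=> cL; rewrite /tensmaps rmorph_sum exchange_big.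
apply: eq_bigr => a _; rewrite rmorph_sum; apply: eq_bigr => a' _.
rewrite rmorphM rmorph_prod; congr (_ * _); apply: eq_bigr => i _.
by rewrite /= cptp_unit_conj.
Qed.

(** The channel keeps the Jordan parts of [A] positive and their traces unchanged; [P] and [N] are
    then added to the respective parts. *)
Lemma trnorm_cptp T U (Phi : Op T -> Op U) (A : Op T) (P N : Op U) :
  cptp Phi -> Defs.hermitian A -> psd P -> psd N ->
  trnorm (fun i j => Phi A i j + (P i j - N i j)) <= trnorm A + (optr P + optr N).
Proof.
move=> cP /trnorm_split[P' [N' [pP' pN' -> ->]]] pP pN.
rewrite lin_sub; last exact: cptp_lin.
have -> : (fun i j => Phi P' i j - Phi N' i j + (P i j - N i j)) =
   (fun i j => (Phi P' i j + P i j) - (Phi N' i j + N i j)).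
  by apply: opP => i j; ring.
have trD V (A1 B1 : Op V) : optr (fun i j => A1 i j + B1 i j) = optr A1 + optr B1.
  by rewrite /optr big_split.
apply: le_trans (trnorm_sub_le _ _) _; [apply: psd_add|apply: psd_add|] => //;
  try exact: cptp_psd.
by rewrite !trD !(cptp_tr _ cP) addrACA.
Qed.

End Channels.

(** * Qubit registers and the EPR check *)

Lemma sum_option (V : nmodType) (K : finType) (F : option K -> V) :
  \sum_o F o = F None + \sum_k F (Some k).
Proof.
rewrite (bigD1 None) //=; congr (_ + _).
rewrite (reindex_omap Some id) => [|[]//].
by apply: eq_bigl => k; rewrite eqxx.
Qed.

Section Registers.
Variables m n : nat.

Definition qcat (u : Qreg m) (v : Qreg n) : Qreg (m + n) :=
  [ffun j => match split j with inl a => u a | inr b => v b end].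
Definition qleft (x : Qreg (m + n)) : Qreg m := [ffun j => x (lshift n j)].
Definition qright (x : Qreg (m + n)) : Qreg n := [ffun j => x (rshift m j)].

Lemma qcatK u v : (qleft (qcat u v), qright (qcat u v)) = (u, v).
Proof.
congr (_, _); apply/ffunP => j; rewrite !ffunE.
  case: splitP => i /= E; first by congr (u _); apply: val_inj.
  by have := ltn_ord j; rewrite E ltnNge leq_addr.
case: splitP => i /= E; last by congr (v _); apply: val_inj; apply: (addnI (esym E)).
by have := ltn_ord i; rewrite -E ltnNge leq_addr.
Qed.

Lemma qleft_cat u v : qleft (qcat u v) = u.
Proof. by have [->] := qcatK u v. Qed.

Lemma qright_cat u v : qright (qcat u v) = v.
Proof. by have [_ ->] := qcatK u v. Qed.

Lemma qcat_split x : qcat (qleft x) (qright x) = x.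
Proof.
apply/ffunP => j; rewrite ffunE; case: splitP => i E; rewrite ffunE;
  by congr (x _); apply: val_inj.
Qed.

Lemma qcat_eq u v u' v' : (qcat u v == qcat u' v') = (u == u') && (v == v').
Proof.
apply/eqP/andP => [E|[/eqP-> /eqP->]//].
by rewrite -(qleft_cat u v) -{2}(qright_cat u v) E qleft_cat qright_cat !eqxx.
Qed.

Lemma card_Qreg : #|Qreg n| = (2 ^ n)%N.
Proof. by rewrite card_ffun card_bool card_ord. Qed.

End Registers.

(** * The EPR measurement in coordinates *)

Section Measurement.
Variable R : realType.
Local Notation C := R[i].
Local Notation Op := (Op R).
Variables (k l : nat) (H : (l <= k)%N).
Local Notation M := (Qreg (k - l)).
Local Notation E := (Qreg l).
Local Notation K := (Qreg k).
Local Notation L := (2 ^+ l : C).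

Definition qjoin (m : M) (e : E) : K :=
  [ffun j => qcat m e (cast_ord (esym (subnK H)) j)].

Lemma qjoinK m e : qsplit H (qjoin m e) = (m, e).
Proof.
rewrite -[RHS](qcatK m e); congr (_, _); apply/ffunP => j; rewrite ffunE [LHS]ffunE [RHS]ffunE;
  by congr (qcat m e _); apply: val_inj.
Qed.

Lemma qsplitK x : qjoin (qsplit H x).1 (qsplit H x).2 = x.
Proof.
apply/ffunP => j; rewrite ffunE /= ffunE; case: splitP => i E; rewrite ffunE;
  by congr (x _); apply: val_inj; rewrite /= -E.
Qed.

Lemma sum_qjoin (V : nmodType) (F : K -> V) : \sum_x F x = \sum_m \sum_e F (qjoin m e).
Proof.
rewrite pair_big (reindex (fun p : M * E => qjoin p.1 p.2)) //=.
by exists (qsplit H) => [[m e] _|x _]; rewrite ?qjoinK ?qsplitK.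
Qed.

Lemma dimE_neq0 : L != 0.
Proof. by rewrite expf_neq0 // pnatr_eq0. Qed.

Lemma card_dimE : #|E|%:R = L.
Proof. by rewrite card_Qreg natrX. Qed.

Lemma sum_const_dimE (c : C) : \sum_(e : E) c = L * c.
Proof. by rewrite sumr_const -card_dimE mulr_natl. Qed.

(** The basis states on which Phi is supported: the decoded E' agrees with hatE. *)
Definition matched (m : M) (e : E) : option K * E := (Some (qjoin m e), e).

(** The projector written inside [newDec], named so that [newDec] can be folded onto it. *)
Definition eprP : Op (option K * E)%type := fun p p' =>
  match p.1, p'.1 with
  | Some x, Some x' => ((qsplit H x).1 == (qsplit H x').1)%:R *
                    epr R ((qsplit H x).2, p.2) ((qsplit H x').2, p'.2)
  | _, _ => 0 end.

(* <Phi| rho |Phi> on the register E' hatE *)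
Definition epr_block (rho : Op (option K * E)%type) : Op M := fun m m' =>
  L^-1 * \sum_e \sum_e' rho (matched m e) (matched m' e').

Definition epr_check (rho : Op (option K * E)%type) : Op (option M) := fun o o' =>
  match o, o' with
  | Some m, Some m' => epr_block rho m m'
  | None, None => optr rho - optr (epr_block rho)
  | _, _ => 0 end.

Lemma eprP_Some x e x' e' :
  eprP (Some x, e) (Some x', e') = ((qsplit H x).1 == (qsplit H x').1)%:R *
    (((qsplit H x).2 == e) && ((qsplit H x').2 == e'))%:R / L.
Proof. exact: mulrA. Qed.

Lemma eprP_qjoin m e eh m' e' eh' :
  eprP (Some (qjoin m e), eh) (Some (qjoin m' e'), eh') =
  (m == m')%:R * (e == eh)%:R * (e' == eh')%:R / L.
Proof.
by rewrite eprP_Some !qjoinK /=; case: (e == eh); case: (e' == eh');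
  rewrite ?(mul1r, mul0r, mulr1, mulr0).
Qed.

Lemma eprP_mull A m e eh q :
  opmul eprP A (Some (qjoin m e), eh) q =
  (e == eh)%:R / L * \sum_e' A (matched m e') q.
Proof.
rewrite /opmul pair_sum sum_option big1 ?add0r => [|eh' _]; last by rewrite mul0r.
rewrite sum_qjoin (bigD1 m) //= [X in _ + X]big1 ?addr0 => [|m' ne]; last first.
  apply: big1 => e' _; apply: big1 => eh' _.
  by rewrite eprP_qjoin eq_sym (negPf ne) !mul0r.
rewrite mulr_sumr; apply: eq_bigr => e' _.
rewrite (bigD1 e') //= big1 ?addr0 => [|eh' ne].
  by rewrite eprP_qjoin !eqxx !mulr1n /matched; ring.
by rewrite eprP_qjoin [e' == _]eq_sym (negPf ne) mulr0 !mul0r.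
Qed.

Lemma eprP_mulr A m e eh q :
  opmul A eprP q (Some (qjoin m e), eh) =
  (e == eh)%:R / L * \sum_e' A q (matched m e').
Proof.
rewrite /opmul pair_sum sum_option big1 ?add0r => [|eh' _]; last by rewrite mulr0.
rewrite sum_qjoin (bigD1 m) //= [X in _ + X]big1 ?addr0 => [|m' ne]; last first.
  apply: big1 => e' _; apply: big1 => eh' _.
  by rewrite eprP_qjoin (negPf ne) !mul0r mulr0.
rewrite mulr_sumr; apply: eq_bigr => e' _.
rewrite (bigD1 e') //= big1 ?addr0 => [|eh' ne].
  by rewrite eprP_qjoin !eqxx !mulr1n /matched; ring.
by rewrite eprP_qjoin [e' == _]eq_sym (negPf ne) mulr0 !mul0r mulr0.
Qed.

Lemma newDecE (t : nat) (ns : 'I_t -> nat)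
    (Dec : Op {dffun forall i, Qreg (ns i)} -> Op (option K)) Y :
  newDec H Dec Y = epr_check (@idtens R _ _ E Dec (oppull (@sh_join t ns l) Y)).
Proof.
rewrite /newDec -/eprP; set rho := @idtens R _ _ E Dec _.
apply: opP => -[m|] [m'|] //; cbv beta iota.
  rewrite sum_qjoin (@sum_only R _ m) => [|m1 ne]; last first.
    apply: big1 => e _; apply: big1 => x _; apply: big1 => eh _.
    by rewrite qjoinK (negPf ne).
  have S e : \sum_x' \sum_eh (if [&& (qsplit H (qjoin m e)).1 == m, (qsplit H x').1 == m'
      & (qsplit H (qjoin m e)).2 == (qsplit H x').2]
      then opmul eprP (opmul rho eprP) (Some (qjoin m e), eh) (Some x', eh) else 0)
    = L^-1 * (L^-1 * \sum_e1 \sum_e2 rho (matched m e1) (matched m' e2)).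
    rewrite sum_qjoin (@sum_only R _ m') => [|m1 ne]; last first.
      apply: big1 => e' _; apply: big1 => eh _.
      by rewrite !qjoinK (negPf ne) andbF.
    rewrite (@sum_only R _ e) => [|e' ne]; last first.
      by apply: big1 => eh _; rewrite !qjoinK /= [e == _]eq_sym (negPf ne) !andbF.
    rewrite (@sum_only R _ e) => [|eh ne]; last first.
      by rewrite eprP_mull [e == _]eq_sym (negPf ne) !mul0r if_same.
    rewrite !qjoinK !eqxx eprP_mull eqxx mul1r; congr (_ * _).
    rewrite mulr_sumr; apply: eq_bigr => e1 _.
    by rewrite eprP_mulr eqxx mul1r.
  (* The two projectors contribute L^-1 each; tracing out the EPR registers sums L equal terms and
     cancels one of them. *)
  under eq_bigr => e _ do rewrite S.
  by rewrite sum_const_dimE mulVKf ?dimE_neq0.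
congr (_ - _); rewrite /optr pair_sum sum_option big1 ?add0r => [|eh _]; last first.
  by rewrite /opmul; apply: big1 => q _; rewrite mul0r.
rewrite sum_qjoin; apply: eq_bigr => m _; rewrite /epr_block [in RHS]exchange_big mulr_sumr.
apply: eq_bigr => e _; rewrite (bigD1 e) //= big1 ?addr0 => [|eh ne].
  by rewrite eprP_mull eqxx mul1r.
by rewrite eprP_mull [e == _]eq_sym (negPf ne) !mul0r.
Qed.

End Measurement.

(** * The EPR check as a channel, and the message padded with a maximally mixed register *)

Section CheckChannel.
Variable R : realType.
Local Notation C := R[i].
Local Notation Op := (Op R).
Variables (k l : nat) (H : (l <= k)%N).
Local Notation M := (Qreg (k - l)).
Local Notation E := (Qreg l).
Local Notation K := (Qreg k).
Local Notation L := (2 ^+ l : C).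
Implicit Types T U : finType.

Lemma dimE_ge0 : 0 <= L. Proof. by rewrite exprn_ge0 // ler0n. Qed.

Lemma epr_block_lin c (A B : Op (option K * E)%type) m m' :
  epr_block H (fun i j => c * A i j + B i j) m m' =
  c * epr_block H A m m' + epr_block H B m m'.
Proof.
rewrite /epr_block mulrCA -mulrDr; congr (_ * _).
rewrite mulr_sumr -big_split; apply: eq_bigr => e _.
by rewrite mulr_sumr -big_split.
Qed.

Lemma optr_lin T c (A B : Op T) :
  optr (fun i j => c * A i j + B i j) = c * optr A + optr B.
Proof. by rewrite /optr mulr_sumr -big_split. Qed.

Lemma epr_check_lin : linear_map (@epr_check R k l H).
Proof.
move=> c A B; apply: opP => -[m|] [m'|] /=; rewrite ?mulr0 ?addr0 //.
  exact: epr_block_lin.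
have -> : epr_block H (fun i j => c * A i j + B i j) =
  fun m m' => c * epr_block H A m m' + epr_block H B m m'.
  by apply: opP => m m'; apply: epr_block_lin.
by rewrite !optr_lin; ring.
Qed.

Lemma psd_difference T U (f g : U -> T) (A : Op T) : psd A ->
  psd (fun i j => A (f i) (f j) + A (g i) (g j) - A (f i) (g j) - A (g i) (f j)).
Proof.
move=> /psd_outer[w ->].
apply: (@psd_ext _ _ (gram (fun=> 1) (fun k i => w k (f i) - w k (g i)))); last first.
  by apply: psd_gram => x; apply: ler01.
move=> i j; rewrite /gram -big_split -!sumrB; apply: eq_bigr => x _.
by rewrite rmorphB /=; ring.
Qed.

(* Exhibits the bot block of the EPR check as a sum of squares. *)
Lemma sum_differences (a : E -> E -> C) :
  \sum_e a e e - L^-1 * (\sum_e \sum_e' a e e') =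
  (L^-1 / 2) * \sum_e \sum_e' (a e e + a e' e' - a e e' - a e' e).
Proof.
have -> : \sum_e \sum_e' (a e e + a e' e' - a e e' - a e' e) =
    2 * (L * \sum_e a e e) - 2 * \sum_e \sum_e' a e e'.
  under eq_bigr => e _ do rewrite !sumrB big_split sum_const_dimE /=.
  rewrite !sumrB big_split /= sum_const_dimE -mulr_sumr.
  by rewrite [X in _ - _ - X]exchange_big /=; ring.
by have := dimE_neq0 R l => ?; field.
Qed.

(** The difficulty is the bot block, a difference of traces. The diagonal is sorted into decoder
    failures, mismatched pairs and matched pairs. The first two enter unchanged; on the matched ones
    I - |Phi><Phi| is a sum of squares of differences by [sum_differences]. *)
Lemma cptp_epr_check : cptp (@epr_check R k l H).
Proof.
split; first exact: epr_check_lin.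
- move=> W X pX.
  (* [S] is the message block and [B] below the bot block of the output; the off-diagonal blocks
     vanish. *)
  pose S : Op (M * W)%type := fun p q => L^-1 *
    \sum_e \sum_e' X (matched H p.1 e, p.2) (matched H q.1 e', q.2).
  have pS : psd S.
    have [v XE] := psd_outer pX.
    apply: (@psd_ext _ _ (gram (fun=> L^-1)
      (fun x p => \sum_e v x (matched H p.1 e, p.2)))); last first.
      by apply: psd_gram => x; rewrite invr_ge0 dimE_ge0.
    move=> p q; rewrite /S XE /gram -mulr_sumr; congr (_ * _).
    under eq_bigr => x _ do rewrite rmorph_sum big_distrlr.
    rewrite exchange_big; apply: eq_bigr => e _.
    rewrite exchange_big; apply: eq_bigr => e' _.
    by apply: eq_bigr => x _; rewrite mul1r.
  pose B : Op W := fun w w' =>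
    (\sum_eh X ((None, eh), w) ((None, eh), w') +
     \sum_m \sum_e \sum_(eh | eh != e)
       X ((Some (qjoin H m e), eh), w) ((Some (qjoin H m e), eh), w')) +
    \sum_m (L^-1 / 2) * \sum_e \sum_e'
      (X (matched H m e, w) (matched H m e, w') +
       X (matched H m e', w) (matched H m e', w') -
       X (matched H m e, w) (matched H m e', w') -
       X (matched H m e', w) (matched H m e, w')).
  have pB : psd B.
    apply: psd_add; first apply: psd_add.
    - by apply: (@psd_sum _ _ E predT (fun eh => oppull (fun w => ((None, eh), w)) X)) => eh;
        exact: psd_oppull.
    - apply: (@psd_sum _ _ M predT) => m; apply: (@psd_sum _ _ E predT) => e.
      by apply: (@psd_sum _ _ E (fun eh => eh != e)
        (fun eh => oppull (fun w => ((Some (qjoin H m e), eh), w)) X)) => eh; exact: psd_oppull.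
    - apply: (@psd_sum _ _ M predT) => m; apply: psd_scale.
        by rewrite divr_ge0 ?invr_ge0 ?dimE_ge0 ?ler0n.
      apply: (@psd_sum _ _ E predT) => e; apply: (@psd_sum _ _ E predT) => e'.
      exact: (psd_difference (fun w => (matched H m e, w)) (fun w => (matched H m e', w)) pX).
  apply: psd_ext (psd_add
    (psd_extend (fun p : option M * W => omap (fun m => (m, p.2)) p.1) pS)
    (psd_extend (fun p : option M * W => if p.1 is None then Some p.2 else None) pB)).
  move=> [[m|] w] [[m'|] w']; rewrite /idtens /= ?addr0 ?add0r //.
  rewrite /B /optr /epr_block pair_sum sum_option (sum_qjoin H) -addrA -addrA; congr (_ + _).
  have E1 m e : \sum_eh X ((Some (qjoin H m e), eh), w) ((Some (qjoin H m e), eh), w') =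
     X (matched H m e, w) (matched H m e, w') + \sum_(eh | eh != e)
       X ((Some (qjoin H m e), eh), w) ((Some (qjoin H m e), eh), w').
    by rewrite (bigD1 e).
  under [X in _ = X - _]eq_bigr => m _ do under eq_bigr => e _ do rewrite E1.
  under [X in _ = X - _]eq_bigr => m _ do rewrite big_split.
  rewrite big_split /= [X in _ = X - _]addrC -addrA; congr (_ + _).
  rewrite -sumrB; apply: eq_bigr => m _.
  by rewrite (sum_differences (fun e e' => X (matched H m e, w) (matched H m e', w'))).
by move=> X; rewrite /optr sum_option /= addrNK.
Qed.

Lemma psd_epr : psd (@epr R l).
Proof.
apply: psd_ext (psd_scale (c := L^-1) _ (psd_rank1 (fun p : E * E => (p.1 == p.2)%:R))).
  by move=> p q; rewrite conjC_nat -natrM mulnb mulrC.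
by rewrite invr_ge0 dimE_ge0.
Qed.

Lemma sum_epr : \sum_(e : E) \sum_(e' : E) epr R (e, e) (e', e') = L.
Proof.
under eq_bigr => e _ do under eq_bigr => e' _ do rewrite /epr /= !eqxx /= mul1r.
by under eq_bigr => e _ do rewrite sum_const_dimE mulfV ?dimE_neq0 //; rewrite sum_const_dimE mulr1.
Qed.

Lemma tr_epr : optr (@epr R l) = 1.
Proof.
rewrite /optr pair_sum; under eq_bigr => e _.
  rewrite (@sum_only _ _ e) => [|e' ne]; last by rewrite /epr /= eq_sym (negPf ne) mul0r.
  rewrite /epr /= !eqxx /= mul1r.
  over.
by rewrite sum_const_dimE mulfV ?dimE_neq0.
Qed.

Definition epr_prep (s : Op M) : Op (K * E)%type := fun p p' =>
  s (qsplit H p.1).1 (qsplit H p'.1).1 *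
  epr R ((qsplit H p.1).2, p.2) ((qsplit H p'.1).2, p'.2).

Lemma cptp_epr_prep : cptp epr_prep.
Proof.
split.
- by move=> c A B; apply: opP => p q; rewrite /epr_prep; ring.
- move=> W X pX.
  exact: (psd_mul
    (psd_oppull (fun p : (K * E) * W => ((qsplit H p.1.1).1, p.2)) pX)
    (psd_oppull (fun p : (K * E) * W => ((qsplit H p.1.1).2, p.1.2)) psd_epr)).
move=> X; rewrite /optr pair_sum (sum_qjoin H); apply: eq_bigr => m _.
under eq_bigr => e _ do under eq_bigr => e' _ do rewrite /epr_prep qjoinK.
rewrite -[RHS]mulr1 -tr_epr /optr pair_sum mulr_sumr; apply: eq_bigr => e _.
by rewrite mulr_sumr.
Qed.

Section Code.
Variables (t : nat) (ns : 'I_t -> nat).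
Local Notation X := {dffun forall i, Qreg (ns i)}.
Variables (Enc : Op K -> Op X) (Dec : Op X -> Op (option K)).
Local Notation join := (@sh_join t ns l).
Local Notation splt := (@sh_split t ns l).

Lemma sh_splitK : cancel splt join.
Proof. by move=> y; apply/ffunP => -[i|]; rewrite !ffunE. Qed.

Lemma sh_joinK : cancel join splt.
Proof.
move=> [x e]; rewrite /sh_split; congr (_, _); last by rewrite ffunE.
by apply/ffunP => i; rewrite !ffunE.
Qed.

Lemma cptp_newEnc : cptp Enc -> cptp (newEnc H Enc).
Proof.
move=> cE.
exact: (cptp_comp (cptp_comp cptp_epr_prep (cptp_idtens E cE)) (cptp_oppull R sh_splitK sh_joinK)).
Qed.

Lemma cptp_newDec : cptp Dec -> cptp (newDec H Dec).
Proof.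
move=> cD.
have -> : newDec H Dec = (fun Y => epr_check H (idtens Dec (oppull join Y))).
  by apply: functional_extensionality => Y; exact: newDecE.
exact: (cptp_comp (cptp_comp (cptp_oppull R sh_joinK sh_splitK) (cptp_idtens E cD)) cptp_epr_check).
Qed.

End Code.

(** What the old encoder receives when hatE is ignored: the message beside one half of the EPR
    pairs. *)
Definition pad_mixed (s : Op M) : Op K := fun w w' =>
  s (qsplit H w).1 (qsplit H w').1 * ((qsplit H w).2 == (qsplit H w').2)%:R / L.

Lemma state_pad s : is_state s -> is_state (pad_mixed s).
Proof.
move=> [ps ts]; split.
  apply: psd_ext (psd_scale (c := L^-1) _ (psd_mul
    (psd_oppull (fun w => (qsplit H w).1) ps)
    (psd_oppull (fun w => (qsplit H w).2) (psd_opid R E)))).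
    by move=> w w'; rewrite /pad_mixed /oppull /opid mulrC.
  by rewrite invr_ge0 dimE_ge0.
rewrite -ts /optr (sum_qjoin H); apply: eq_bigr => m _.
under eq_bigr => e _ do rewrite /pad_mixed qjoinK /= eqxx mulr1.
by rewrite sum_const_dimE mulrC divfK ?dimE_neq0.
Qed.

(** The identity is its own root, so only the scalar 1/L needs a square root; [sqrtmE] confirms the
    candidate. *)
Lemma sqrtm_pad s : is_state s -> sqrtm (pad_mixed s) = fun w w' =>
  sqrtC L^-1 * (sqrtm s (qsplit H w).1 (qsplit H w').1 * ((qsplit H w).2 == (qsplit H w').2)%:R).
Proof.
move=> [ps _]; have [pS SE] := sqrtm_psd_sqr ps; apply: sqrtmE.
  apply: psd_scale; first by rewrite sqrtC_ge0 invr_ge0 dimE_ge0.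
  exact: (psd_mul
    (psd_oppull (fun w => (qsplit H w).1) pS)
    (psd_oppull (fun w => (qsplit H w).2) (psd_opid R E))).
have sE i j : s i j = \sum_m sqrtm s i m * sqrtm s m j by rewrite -{1}SE.
apply: opP => w w'; rewrite /opmul (sum_qjoin H) /pad_mixed sE mulr_suml mulr_suml.
apply: eq_bigr => m _; rewrite (@sum_only _ _ (qsplit H w).2) => [|e ne]; last first.
  by rewrite qjoinK /= [_ == e]eq_sym (negPf ne) !mulr0 mul0r.
rewrite qjoinK eqxx mulr1n mulr1.
transitivity (sqrtC L^-1 ^+ 2 * (sqrtm s (qsplit H w).1 m * sqrtm s m (qsplit H w').1 *
  ((qsplit H w).2 == (qsplit H w').2)%:R)); first by rewrite /=; ring.
by rewrite sqrtCK mulrC.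
Qed.

(** This is where hatE becomes part of the reference: sqrt(I/L) purifies to the EPR vector
    itself. *)
Lemma purif_pad s w h w' h' : is_state s ->
  purif (pad_mixed s) (w, h) (w', h') =
  purif s ((qsplit H w).1, (qsplit H h).1) ((qsplit H w').1, (qsplit H h').1) *
  epr R ((qsplit H w).2, (qsplit H h).2) ((qsplit H w').2, (qsplit H h').2).
Proof.
move=> ss; rewrite /purif /ketbra sqrtm_pad // /epr.
have cr : (sqrtC L^-1)^* = sqrtC L^-1 by apply: conj_nneg; rewrite sqrtC_ge0 invr_ge0 dimE_ge0.
rewrite !rmorphM /= cr conjC_nat -mulnb natrM -{3}(sqrtCK L^-1); ring.
Qed.

Lemma state_purif T (s : Op T) : is_state s -> is_state (purif s).
Proof.
move=> [ps ts]; split; first exact: psd_rank1.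
have [[/hermP hS _] SE] := sqrtm_psd_sqr ps.
have sE i j : s i j = \sum_m sqrtm s i m * sqrtm s m j by rewrite -{1}SE.
rewrite -ts /optr pair_sum; apply: eq_bigr => i _; rewrite sE; apply: eq_bigr => j _.
by rewrite /purif /ketbra /= (hS i j).
Qed.

Lemma state_hat_marg T (s : Op T) : is_state s -> is_state (hat_marg s).
Proof.
move=> /state_purif [pp tp]; split.
  by apply: (@psd_sum _ _ T predT (fun t => oppull (fun i => (t, i)) (purif s))) => t; exact: psd_oppull.
by rewrite -tp /optr pair_sum exchange_big.
Qed.

Lemma hat_marg_pad s h h' : is_state s ->
  hat_marg (pad_mixed s) h h' =
  hat_marg s (qsplit H h).1 (qsplit H h').1 * (((qsplit H h).2 == (qsplit H h').2)%:R / L).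
Proof.
move=> ss; rewrite /hat_marg /ptr1 (sum_qjoin H) mulr_suml; apply: eq_bigr => m _.
rewrite (@sum_only _ _ (qsplit H h).2) => [|e ne]; rewrite purif_pad // qjoinK.
  by rewrite /epr /= eqxx.
by rewrite /epr /= (negPf ne) mul0r mulr0.
Qed.

End CheckChannel.

(** * The extended code *)

Section CodeCorrectness.
Variable R : realType.
Local Notation C := R[i].
Local Notation Op := (Op R).
Variables (k l : nat) (H : (l <= k)%N).
Local Notation M := (Qreg (k - l)).
Local Notation E := (Qreg l).
Local Notation K := (Qreg k).
Local Notation L := (2 ^+ l : C).

(** The overlap <Phi| X |Phi>. *)
Definition epr_fidelity (X : Op (E * E)%type) : C :=
  L^-1 * \sum_e \sum_e' X (e, e) (e', e').

(** Used with X = Phi for correctness and with Phi tampered on one side for the same part. [S] need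
    not be a state: it will be a block of the purification at fixed reference indices. *)
Lemma epr_check_prod (S : Op M) (X : Op (E * E)%type) :
  epr_check H (fun p q => match p.1, q.1 with
    | Some w, Some w' => S (qsplit H w).1 (qsplit H w').1 *
                         X ((qsplit H w).2, p.2) ((qsplit H w').2, q.2)
    | _, _ => 0 end) =
  fun o o' => match o, o' with
    | Some m, Some m' => epr_fidelity X * S m m'
    | None, None => (optr X - epr_fidelity X) * optr S
    | _, _ => 0 end.
Proof.
have B m m' : epr_block H (fun p q => match p.1, q.1 with
    | Some w, Some w' => S (qsplit H w).1 (qsplit H w').1 *
                         X ((qsplit H w).2, p.2) ((qsplit H w').2, q.2)
    | _, _ => 0 end) m m' = epr_fidelity X * S m m'.
  rewrite /epr_block /epr_fidelity -mulrA; congr (_ * _); rewrite mulr_suml.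
  apply: eq_bigr => e _; rewrite mulr_suml; apply: eq_bigr => e' _.
  by rewrite /matched; cbv beta iota; rewrite !qjoinK mulrC.
apply: opP => -[m|] [m'|] //; first exact: B.
rewrite /epr_check [X in _ - X](eq_bigr _ (fun m _ => B m m)) -mulr_sumr -/(optr S).
rewrite mulrBl; congr (_ - _).
rewrite [in LHS]/optr pair_sum sum_option [X in X + _]big1 ?add0r => [|//].
rewrite (sum_qjoin H) mulrC /optr mulr_suml; apply: eq_bigr => m _.
rewrite pair_sum mulr_sumr; apply: eq_bigr => e _; rewrite mulr_sumr; apply: eq_bigr => e' _.
by rewrite qjoinK.
Qed.

Lemma epr_prep_purif (s : Op M) h h' w e w' e' : is_state s ->
  epr_prep H (fun i j => purif s (i, h) (j, h')) (w, e) (w', e') =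
  purif (pad_mixed H s) (w, qjoin H h e) (w', qjoin H h' e').
Proof. by move=> ss; rewrite purif_pad // !qjoinK. Qed.

(** By [epr_prep_purif] the untampered new codeword is the old codeword of the padded purification.
    Old correctness returns [purif s] beside intact EPR pairs, which pass the check with
    certainty. *)
Lemma is_code_new (t : nat) (ns : 'I_t -> nat)
    (Enc : Op K -> Op {dffun forall i, Qreg (ns i)})
    (Dec : Op {dffun forall i, Qreg (ns i)} -> Op (option K)) :
  is_code Enc Dec -> is_code (newEnc H Enc) (newDec H Dec).
Proof.
move=> [cE cD ED]; split; [exact: cptp_newEnc|exact: cptp_newDec|].
move=> s ss; apply: opP => -[o h] [o' h'].
rewrite {1}/idtens newDecE /=.
have -> : @idtens R _ _ E Dec (oppull (@sh_join t ns l)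
     (fun i j => idtens (newEnc H Enc) (purif s) (i, h) (j, h'))) =
   (fun p q => match p.1, q.1 with
    | Some w, Some w' => (fun i j => purif s (i, h) (j, h')) (qsplit H w).1 (qsplit H w').1 *
                         epr R ((qsplit H w).2, p.2) ((qsplit H w').2, q.2)
    | _, _ => 0 end).
  apply: opP => -[om e] [om' e'].
  transitivity (emb1 (purif (pad_mixed H s)) (om, qjoin H h e) (om', qjoin H h' e')).
    rewrite -ED; last exact: state_pad.
    rewrite /idtens /=; congr (Dec _ om om'); apply: opP => x x'.
    rewrite /oppull /newEnc /oppull !sh_joinK /idtens /=.
    by congr (Enc _ x x'); apply: opP => w w'; apply: epr_prep_purif.
  case: om => [w|] //; case: om' => [w'|] //.
  rewrite -[LHS]/(purif (pad_mixed H s) (w, qjoin H h e) (w', qjoin H h' e')).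
  by rewrite purif_pad // !qjoinK.
rewrite (epr_check_prod (fun i j => purif s (i, h) (j, h'))) /epr_fidelity.
rewrite sum_epr mulVf ?dimE_neq0 // tr_epr subrr mul0r.
by rewrite /emb1 /=; case: o => [m|]; case: o' => [m'|]; rewrite ?mul1r.
Qed.

End CodeCorrectness.

(** * Recovering the new experiment from the old one *)

Section Recovery.
Variable R : realType.
Local Notation C := R[i].
Local Notation Op := (Op R).
Variables (k l : nat) (H : (l <= k)%N).
Local Notation M := (Qreg (k - l)).
Local Notation E := (Qreg l).
Local Notation K := (Qreg k).
Local Notation L := (2 ^+ l : C).
(** [G] holds the entanglement of the last share, [G'] is its copy kept by share 1, and [F0] is
    share 1's own output environment. [N] below is the last tampering map with its output
    environment traced out. *)
Variables (G G' F0 : finType) (sp : G -> G') (sp' : G' -> G).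
Hypothesis spK : cancel sp sp'.
Hypothesis sp'K : cancel sp' sp.
Variable N : Op (E * G)%type -> Op E.
Hypothesis cN : cptp N.

Lemma epr_fidelityE (X : Op (E * E)%type) :
  epr_fidelity X = \sum_p \sum_q X p q * epr R p q.
Proof.
rewrite /epr_fidelity pair_sum mulr_sumr; apply: eq_bigr => e _.
rewrite [RHS](@sum_only _ _ e) => [|e' ne]; last first.
  by apply: big1 => q _; rewrite /epr /= eq_sym (negPf ne) mul0r mulr0.
rewrite pair_sum mulr_sumr; apply: eq_bigr => e' _.
rewrite [RHS](@sum_only _ _ e') => [|e1 ne]; last first.
  by rewrite /epr /= [e' == _]eq_sym (negPf ne) andbF mul0r mulr0.
by rewrite /epr /= !eqxx mul1r mulrC.
Qed.

(** The lower bound evaluates the Schur product of [X] and Phi at the all-ones vector; the upper one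
    is [optr_mul_le] with both traces 1. *)
Lemma epr_fidelity_bounds (X : Op (E * E)%type) : is_state X ->
  0 <= epr_fidelity X <= 1.
Proof.
move=> [pX tX]; rewrite epr_fidelityE; apply/andP; split.
  have [_ /(_ (fun=> 1))] := psd_mul pX (psd_epr R l).
  congr (_ <= _); apply: eq_bigr => p _; apply: eq_bigr => q _.
  by rewrite rmorph1 mul1r mulr1.
by apply: le_trans (optr_mul_le pX (psd_epr R l)) _; rewrite tX tr_epr mulr1.
Qed.

Lemma state_apply (W : finType) (X : Op ((E * G) * W)%type) : is_state X ->
  is_state (fun p p' : W * E => N (fun u u' => X (u, p.1) (u', p'.1)) p.2 p'.2).
Proof.
move=> sX.
have sw : cancel (fun p : W * E => (p.2, p.1)) (fun p => (p.2, p.1)) by case.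
have sw' : cancel (fun p : E * W => (p.2, p.1)) (fun p => (p.2, p.1)) by case.
exact: (cptp_state (cptp_oppull R sw sw') (cptp_state (cptp_idtens W cN) sX)).
Qed.

(** Brings the inputs of [N] to the front: hatE is cut out of the old reference and paired with the
    stored qubits. *)
Definition regroup (X : Op ((option K * K) * (F0 * G'))%type) :
    Op ((E * G) * (option K * M))%type := fun p p' =>
  \sum_f X ((p.2.1, qjoin H p.2.2 p.1.1), (f, sp p.1.2))
           ((p'.2.1, qjoin H p'.2.2 p'.1.1), (f, sp p'.1.2)).

Definition recover (X : Op ((option K * K) * (F0 * G'))%type) : Op (option M * M)%type :=
  @idtens R _ _ M (epr_check H) (fun p p' =>
    N (fun u u' => regroup X (u, (p.1.1, p.2)) (u', (p'.1.1, p'.2))) p.1.2 p'.1.2).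

Lemma cptp_recover : cptp recover.
Proof.
have c1 : cptp regroup.
  apply: (@cptp_ptrace R _ _ F0
    (fun f (p : (E * G) * (option K * M)) => ((p.2.1, qjoin H p.2.2 p.1.1), (f, sp p.1.2)))
    (fun x => (x.2.1, (((qsplit H x.1.2).2, sp' x.2.2), (x.1.1, (qsplit H x.1.2).1))))).
    by move=> f [[e g] [o m]]; rewrite [in (_, _).2]/= qjoinK /= spK.
  move=> [[o x] [f g]]; rewrite -[RHS](_ : ((o, qjoin H (qsplit H x).1 (qsplit H x).2), (f, sp (sp' g))) = _) //.
  by rewrite qsplitK sp'K.
have c2 := cptp_comp c1 (cptp_idtens (option K * M)%type cN).
pose f (p : (option K * E) * M) := (p.1.2, (p.1.1, p.2)).
pose f' (p : E * (option K * M)) := ((p.2.1, p.1), p.2.2).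
have fK : cancel f f' by move=> [[]].
have fK' : cancel f' f by move=> [x []].
exact: (cptp_comp (cptp_comp c2 (cptp_oppull R fK fK')) (cptp_idtens M (cptp_epr_check R H))).
Qed.

Definition env_marg (zeta : Op (F0 * G')%type) : Op G := fun c c' =>
  \sum_f zeta (f, sp c) (f, sp c').

Lemma state_env_marg zeta : is_state zeta -> is_state (env_marg zeta).
Proof.
apply: cptp_state; apply: (@cptp_ptrace R _ _ F0 (fun f c => (f, sp c)) (fun x => (x.1, sp' x.2))).
  by move=> f c /=; rewrite spK.
by move=> [f g] /=; rewrite sp'K.
Qed.

Lemma state_tens (T U : finType) (A : Op T) (B : Op U) :
  is_state A -> is_state B -> is_state (fun p p' : T * U => A p.1 p'.1 * B p.2 p'.2).
Proof.
move=> [pA tA] [pB tB]; split.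
  exact: (psd_mul (psd_oppull (@fst T U) pA) (psd_oppull (@snd T U) pB)).
rewrite -[1]mulr1 -{1}tA -tB /optr pair_sum mulr_suml; apply: eq_bigr => i _.
by rewrite mulr_sumr.
Qed.

Lemma state_reindex (T U : finType) (f : T -> U) (g : U -> T) (A : Op U) :
  cancel f g -> cancel g f -> is_state A -> is_state (oppull f A).
Proof. by move=> fK gK; apply: cptp_state; apply: cptp_oppull fK gK. Qed.

Lemma recover_same zeta : is_state zeta -> exists f : R, 0 <= f <= 1 /\
  forall s : Op M, is_state s ->
  recover (fun r r' => emb1 (purif (pad_mixed H s)) r.1 r'.1 * zeta r.2 r'.2) =
  fun r r' => f%:C%C * emb1 (purif s) r r' +
              (1 - f%:C%C) * (@botop R M r.1 r'.1 * hat_marg s r.2 r'.2).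
Proof.
move=> sz.
(* Half of the EPR pairs after [N], with the stored qubits taken from [zeta]. The message is absent
   from it, so its fidelity serves every [s] at once. *)
pose X : Op (E * E)%type := fun p p' =>
  N (fun u u' => epr R (p.1, u.1) (p'.1, u'.1) * env_marg zeta u.2 u'.2) p.2 p'.2.
have sX : is_state X.
  pose g (p : (E * G) * E) := ((p.2, p.1.1), p.1.2).
  pose g' (p : (E * E) * G) := ((p.1.2, p.2), p.1.1).
  have gK : cancel g g' by move=> [[]].
  have gK' : cancel g' g by move=> [[]].
  have se : is_state (@epr R l) by split; [exact: psd_epr | exact: tr_epr].
  exact: (state_apply (state_reindex gK gK' (state_tens se (state_env_marg sz)))).
have /andP[f0 f1] := epr_fidelity_bounds sX.
have fR : (complex.Re (epr_fidelity X))%:C%C = epr_fidelity X.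
  by have := f0; case: (epr_fidelity X) => x y; rewrite lecE /= => /andP[/eqP-> _].
exists (complex.Re (epr_fidelity X)); split; first by rewrite -!lecR fR f0.
move=> s ss; rewrite fR; apply: opP => -[o h] [o' h'].
rewrite /recover {1}/idtens.
set Y := (fun i j : option K * E => _).
have -> : Y = fun p q => match p.1, q.1 with
    | Some w, Some w' => (fun i j => purif s (i, h) (j, h')) (qsplit H w).1 (qsplit H w').1 *
                         X ((qsplit H w).2, p.2) ((qsplit H w').2, q.2)
    | _, _ => 0 end.
  apply: opP => -[om e] [om' e']; rewrite /Y.
  (* Entries with a decoder bot vanish because [emb1] is 0 there. *)
  have Z : N (fun _ _ => 0) e e' = 0 by rewrite (lin_zero (cptp_lin cN)).
  case: om => [w|]; last first.
    rewrite -[RHS]Z; congr (N _ e e'); apply: opP => u u'.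
    by apply: big1 => f _; rewrite mul0r.
  case: om' => [w'|]; last first.
    rewrite -[RHS]Z; congr (N _ e e'); apply: opP => u u'.
    by apply: big1 => f _; rewrite mul0r.
  cbv beta iota.
  rewrite /X; pose S := purif s ((qsplit H w).1, h) ((qsplit H w').1, h').
  have := lin_scale (cptp_lin cN) S (fun u u' =>
     epr R ((qsplit H w).2, u.1) ((qsplit H w').2, u'.1) * env_marg zeta u.2 u'.2).
  move=> /(congr1 (fun f => f e e')) /= SE; rewrite -[RHS]SE; congr (N _ e e'); apply: opP => u u'.
  rewrite mulrA /regroup /env_marg mulr_sumr; apply: eq_bigr => f _; congr (_ * _).
  by rewrite -[LHS]/(purif (pad_mixed H s) (w, qjoin H h u.1) (w', qjoin H h' u'.1))
     purif_pad // !qjoinK.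
rewrite {Y}(epr_check_prod H (fun i j => purif s (i, h) (j, h'))) /=.
case: sX => _ ->.
case: o => [m|]; case: o' => [m'|]; rewrite /emb1 /botop /= ?mul0r ?mulr0 ?addr0 ?add0r //.
by rewrite mul1r.
Qed.

Definition fresh (gam : Op (option K * (F0 * G'))%type) : Op (option K * E)%type := fun p p' =>
  N (fun u u' => (\sum_f gam (p.1, (f, sp u.2)) (p'.1, (f, sp u'.2))) *
                 ((u.1 == u'.1)%:R / L)) p.2 p'.2.

Lemma state_unif : is_state (fun e e' : E => (e == e')%:R / L).
Proof.
split; last first.
  rewrite /optr; under eq_bigr => e _ do rewrite eqxx mul1r.
  by rewrite sum_const_dimE mulfV ?dimE_neq0.
apply: psd_ext (psd_scale (c := L^-1) _ (psd_opid R E)) => [e e'|]; first by rewrite mulrC.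
by rewrite invr_ge0 dimE_ge0.
Qed.

Definition code_env (gam : Op (option K * (F0 * G'))%type) : Op (option K * G)%type :=
  fun p p' => \sum_f gam (p.1, (f, sp p.2)) (p'.1, (f, sp p'.2)).

Lemma state_code_env gam : is_state gam -> is_state (code_env gam).
Proof.
apply: cptp_state; apply: (@cptp_ptrace R _ _ F0 (fun f p => (p.1, (f, sp p.2)))
  (fun x => (x.2.1, (x.1, sp' x.2.2)))).
  by move=> f [o c] /=; rewrite spK.
by move=> [o [f g]] /=; rewrite sp'K.
Qed.

Lemma state_fresh gam : is_state gam -> is_state (fresh gam).
Proof.
move=> sg.
pose g (p : (E * G) * option K) := ((p.2, p.1.2), p.1.1).
pose g' (p : (option K * G) * E) := ((p.2, p.1.2), p.1.1).
have gK : cancel g g' by move=> [[]].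
have gK' : cancel g' g by move=> [[]].
exact: (state_apply (state_reindex gK gK' (state_tens (state_code_env sg) state_unif))).
Qed.

(** The reference marginal of the padded message is that of [s] times the uniform state on hatE. The
    first factor is a scalar at fixed indices and passes through [N] and the check by linearity; the
    second is the input hatE in [fresh]. *)
Lemma recover_fresh gam (s : Op M) : is_state s ->
  recover (fun r r' => gam (r.1.1, r.2) (r'.1.1, r'.2) * hat_marg (pad_mixed H s) r.1.2 r'.1.2) =
  fun r r' => epr_check H (fresh gam) r.1 r'.1 * hat_marg s r.2 r'.2.
Proof.
move=> ss; apply: opP => -[o h] [o' h'].
rewrite /recover {1}/idtens /= mulrC.
have := lin_scale (@epr_check_lin R k l H) (hat_marg s h h') (fresh gam).
move=> /(congr1 (fun f => f o o')) => <-; congr (epr_check H _ o o'); apply: opP => p p'.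
have := lin_scale (cptp_lin cN) (hat_marg s h h') (fun u u' =>
  code_env gam (p.1, u.2) (p'.1, u'.2) * ((u.1 == u'.1)%:R / L)).
rewrite /fresh => /(congr1 (fun f => f p.2 p'.2)) => <-.
congr (N _ p.2 p'.2); apply: opP => u u'.
rewrite mulrCA /code_env mulr_suml; apply: eq_bigr => f _.
by rewrite hat_marg_pad // !qjoinK.
Qed.

(* The Choi matrix of [N] with the register E fed with the maximally mixed state. *)
Definition choi : Op (G * E)%type := fun p p' =>
  N (fun u u' => unitop R p.1 p'.1 u.2 u'.2 * ((u.1 == u'.1)%:R / L)) p.2 p'.2.

(** [N] acts here on the unnormalized maximally entangled vector of two copies of [G], beside the
    uniform state on E. *)
Lemma psd_choi : psd choi.
Proof.
pose X : Op ((E * G) * G)%type := fun z z' =>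
  ((z.1.2 == z.2)%:R * ((z'.1.2 == z'.2)%:R)^*) * ((z.1.1 == z'.1.1)%:R / L).
have pX : psd X.
  apply: (psd_mul (psd_rank1 (fun z : (E * G) * G => (z.1.2 == z.2)%:R))
    (psd_oppull (fun z : (E * G) * G => z.1.1) (proj1 state_unif))).
have := psd_oppull (fun p : G * E => (p.2, p.1)) (cptp_psd (cptp_idtens G cN) pX).
apply: psd_ext => -[c e] [c' e']; rewrite /oppull /idtens /choi /=.
congr (N _ e e'); apply: opP => u u'; rewrite /X /unitop /= conjC_nat.
by rewrite -natrM mulnb.
Qed.

Lemma tr_choi : optr choi = #|G|%:R.
Proof.
rewrite /optr pair_sum -sum1_card natr_sum; apply: eq_bigr => c _.
pose Z : Op (E * G)%type := fun u u' => ((u.1 == u'.1)%:R / L) * unitop R c c u.2 u'.2.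
have <- : optr Z = 1.
  rewrite -(proj2 state_unif) /optr pair_sum; apply: eq_bigr => e _.
  rewrite (@sum_only _ _ c) => [|c' ne]; rewrite /Z /unitop /=.
    by rewrite !eqxx mulr1.
  by rewrite (negPf ne) mulr0.
rewrite -(cptp_tr Z cN); apply: eq_bigr => e _; rewrite /choi /=.
by congr (N _ e e); apply: opP => u u'; rewrite mulrC.
Qed.

Lemma fresh_fidelity_le gam : is_state gam ->
  optr (epr_block H (fresh gam)) <= #|G|%:R / L.
Proof.
move=> sg.
have [pc tc] := state_code_env sg.
(* M' is traced out and the decoder's bot outcome is dropped, which is why the trace is only at most
   1. *)
pose g2 : Op (G * E)%type := fun p p' =>
  \sum_m code_env gam (Some (qjoin H m p.2), p.1) (Some (qjoin H m p'.2), p'.1).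
have p2 : psd g2.
  by apply: (@psd_sum _ _ M predT (fun m =>
    oppull (fun p : G * E => (Some (qjoin H m p.2), p.1)) (code_env gam))) => m; exact: psd_oppull.
have t2 : optr g2 <= 1.
  rewrite -tc /optr [X in _ <= X]pair_sum sum_option.
  rewrite (_ : \sum_p g2 p p = \sum_x \sum_c code_env gam (Some x, c) (Some x, c)).
    by rewrite lerDr; apply: sumr_ge0 => c _; apply: psd_diag_ge0.
  rewrite (sum_qjoin H) pair_sum exchange_big /=.
  under eq_bigr => e _ do rewrite exchange_big /=.
  rewrite exchange_big; apply: eq_bigr => m _; apply: eq_bigr => e _.
  by [].
have -> : optr (epr_block H (fresh gam)) = L^-1 * \sum_p \sum_q g2 p q * choi p q.
  rewrite /optr /epr_block -mulr_sumr; congr (_ * _).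
  (* Expanding the stored qubits in matrix units of [G] exposes the entries of [choi]. *)
  have FE e e' m : fresh gam (matched H m e) (matched H m e') = \sum_c \sum_c'
      code_env gam (Some (qjoin H m e), c) (Some (qjoin H m e'), c') * choi (c, e) (c', e').
    pose A : Op G := fun c c' => code_env gam (Some (qjoin H m e), c) (Some (qjoin H m e'), c').
    have := lin_sum (cptp_lin cN) (fun p : G * G => A p.1 p.2)
      (fun p u u' => unitop R p.1 p.2 u.2 u'.2 * ((u.1 == u'.1)%:R / L)).
    move=> /(congr1 (fun f => f e e')); rewrite pair_sum /= => <-.
    congr (N _ e e'); apply: opP => u u'.
    have := congr1 (fun f => f u.2 u'.2) (op_units A); rewrite /= => AE.
    rewrite -[X in X * _]/(A u.2 u'.2) AE mulr_suml; apply: eq_bigr => p _.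
    by rewrite mulrA.
  under eq_bigr => m _ do under eq_bigr => e _ do under eq_bigr => e' _ do rewrite FE.
  under [RHS]eq_bigr => p _ do under eq_bigr => q _ do rewrite mulr_suml.
  under [RHS]eq_bigr => p _ do rewrite exchange_big.
  rewrite [RHS]exchange_big; apply: eq_bigr => m _.
  rewrite [RHS]pair_sum [RHS]exchange_big; apply: eq_bigr => e _.
  rewrite [LHS]exchange_big; apply: eq_bigr => c _.
  by rewrite [RHS]pair_sum [RHS]exchange_big.
rewrite mulrC; apply: ler_wpM2r; first by rewrite invr_ge0 dimE_ge0.
apply: le_trans (optr_mul_le p2 psd_choi) _; rewrite tr_choi.
by rewrite -[X in _ <= X]mul1r; apply: ler_wpM2r => //; rewrite ler0n.
Qed.

End Recovery.

(** * Moving the last share environment into share 1 *)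

Lemma prod_option (V : comNzRingType) (K : finType) (F : option K -> V) :
  \prod_o F o = F None * \prod_k F (Some k).
Proof.
rewrite (bigD1 None) //=; congr (_ * _).
rewrite (reindex_omap Some id) => [|[]//].
by apply: eq_bigl => k; rewrite eqxx.
Qed.

Section DependentProducts.
Variables (I : finType).

Definition dzip (A B : I -> finType) (a : {dffun forall i, A i}) (b : {dffun forall i, B i}) :
  {dffun forall i, (A i * B i)%type} := [ffun i => (a i, b i)].
Definition dfst (A B : I -> finType) (z : {dffun forall i, (A i * B i)%type}) :
  {dffun forall i, A i} := [ffun i => (z i).1].
Definition dsnd (A B : I -> finType) (z : {dffun forall i, (A i * B i)%type}) :
  {dffun forall i, B i} := [ffun i => (z i).2].
Definition djoin (B : option I -> finType) (b : {dffun forall i, B (Some i)}) (c : B None) :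
  {dffun forall o, B o} :=
  [ffun o => match o as o' return B o' with Some i => b i | None => c end].
Definition dSome (B : option I -> finType) (z : {dffun forall o, B o}) :
  {dffun forall i, B (Some i)} := [ffun i => z (Some i)].

Lemma dfst_zip (A B : I -> finType) a b : dfst (@dzip A B a b) = a.
Proof. by apply/ffunP => i; rewrite !ffunE. Qed.

Lemma djoin_Some (B : option I -> finType) b c i : @djoin B b c (Some i) = b i.
Proof. by rewrite ffunE. Qed.

Lemma djoin_None (B : option I -> finType) b c : @djoin B b c None = c.
Proof. by rewrite ffunE. Qed.

Lemma dSome_join (B : option I -> finType) b c : dSome (@djoin B b c) = b.
Proof. by apply/ffunP => i; rewrite !ffunE. Qed.

Lemma djoinK (B : option I -> finType) z : @djoin B (dSome z) (z None) = z.
Proof. by apply/ffunP => -[i|]; rewrite !ffunE. Qed.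

Lemma sum_djoin (V : nmodType) (B : option I -> finType) (F : {dffun forall o, B o} -> V) :
  \sum_z F z = \sum_b \sum_c F (djoin b c).
Proof.
rewrite pair_big (reindex (fun p => djoin p.1 p.2)) //=.
exists (fun z => (dSome z, z None)) => [[b c] _|z _].
  by rewrite dSome_join djoin_None.
exact: djoinK.
Qed.

Lemma prod_delta (R : comNzRingType) (B : I -> finType) (a b : {dffun forall i, B i}) :
  \prod_i ((a i == b i)%:R : R) = (a == b)%:R.
Proof.
have [->|ne] := eqVneq a b; first by rewrite big1 // => i _; rewrite eqxx.
have /existsP[i /negPf ni] : [exists i, a i != b i].
  apply: contraR ne; rewrite negb_exists => /forallP ab.
  by apply/eqP/ffunP => i; apply/eqP; rewrite -[_ == _]negbK ab.
by rewrite (bigD1 i) //= ni mul0r.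
Qed.

End DependentProducts.

(** * The old and the new experiment in coordinates *)

Section Experiment.
Variable R : realType.
Local Notation C := R[i].
Local Notation Op := (Op R).

Lemma lin_bigsum (T U K : finType) (Phi : Op T -> Op U) (A : K -> Op T) : linear_map Phi ->
  Phi (fun i j => \sum_k A k i j) = fun i j => \sum_k Phi (A k) i j.
Proof.
move=> lP; have := lin_sum lP (fun=> 1) A.
have -> : (fun i j => \sum_k 1 * A k i j) = (fun i j => \sum_k A k i j).
  by apply: opP => i j; apply: eq_bigr => x _; rewrite mul1r.
by move=> ->; apply: opP => i j; apply: eq_bigr => x _; rewrite mul1r.
Qed.

Lemma experimentE (Mt I : finType) (X : I -> finType)
    (Enc : Op Mt -> Op {dffun forall i, X i})
    (Dec : Op {dffun forall i, X i} -> Op (option Mt))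
    (q : I -> nat) (F : I -> finType)
    (Lam : forall i, Op (X i * Qreg (q i))%type -> Op (X i * F i)%type)
    (psi : Vec R {dffun forall i, Qreg (q i)}) (s : Op Mt) m f h m' f' h' :
  experiment Enc Dec Lam psi s ((m, f), h) ((m', f'), h') =
  Dec (fun x x' => \sum_z \sum_z'
    (Enc (fun i j => purif s (i, h) (j, h')) (dfst z) (dfst z') *
     (psi (dsnd z) * (psi (dsnd z'))^*)) *
    \prod_i Lam i (unitop R (z i) (z' i)) (x i, f i) (x' i, f' i)) m m'.
Proof.
rewrite /experiment {1}/idtens /=; congr (Dec _ m m'); apply: opP => x x'.
rewrite {1}/idtens /= /tensmaps; apply: eq_bigr => z _; apply: eq_bigr => z' _.
by congr (_ * _); apply: eq_bigr => i _; rewrite !ffunE.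
Qed.

Lemma experiment_herm (Mt I : finType) (X : I -> finType)
    (Enc : Op Mt -> Op {dffun forall i, X i})
    (Dec : Op {dffun forall i, X i} -> Op (option Mt))
    (q : I -> nat) (F : I -> finType)
    (Lam : forall i, Op (X i * Qreg (q i))%type -> Op (X i * F i)%type)
    (psi : Vec R {dffun forall i, Qreg (q i)}) (s : Op Mt) :
  cptp Enc -> cptp Dec -> (forall i, cptp (Lam i)) ->
  Defs.hermitian (experiment Enc Dec Lam psi s).
Proof.
move=> cE cD cL; apply/hermP => -[[m f] h] [[m' f'] h'].
rewrite /experiment; cbv zeta.
set r5 := idtens Dec _.
suff : Defs.hermitian r5 by move/hermP; apply.
apply: (cptp_herm (cptp_idtens _ cD)).
set r3 := idtens (tensmaps Lam) _.
suff /hermP h3 : Defs.hermitian r3 by apply/hermP => p p'; exact: h3.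
suff hT (Y : Op ({dffun forall i, X i * Qreg (q i)} * Mt)%type) :
    Defs.hermitian Y -> Defs.hermitian (@idtens R _ _ Mt (tensmaps Lam) Y).
  apply: hT; apply/hermP => z z'.
  have [/hermP hE _] : psd (@idtens R _ _ Mt Enc (purif s)).
    by apply: cptp_psd; [exact: cptp_idtens | exact: psd_rank1].
  by rewrite rmorphM /= hE /ketbra rmorphM /= conjCK; ring.
move=> /hermP hY; apply/hermP => -[y g] [y' g'].
rewrite /idtens tensmaps_conj //; congr (tensmaps _ _ _ _); apply: opP => i j.
exact: hY.
Qed.

Section Reduction.
Variables (k l : nat) (H : (l <= k)%N).
Local Notation M := (Qreg (k - l)).
Local Notation E := (Qreg l).
Local Notation K := (Qreg k).
Variables (t : nat) (ns : 'I_t -> nat) (i0 : 'I_t).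
Variables (Enc : Op K -> Op {dffun forall i, Qreg (ns i)})
  (Dec : Op {dffun forall i, Qreg (ns i)} -> Op (option K)).
Variables (q : option 'I_t -> nat) (F : option 'I_t -> finType).
Variable Lam : forall o, Op (Qreg (ext_ns ns l o) * Qreg (q o))%type ->
                         Op (Qreg (ext_ns ns l o) * F o)%type.
Arguments Lam : clear implicits.
Variable psi : Vec R {dffun forall o, Qreg (q o)}.
Hypothesis cE : cptp Enc.
Hypothesis cD : cptp Dec.
Hypothesis cL : forall o, cptp (Lam o).

(* Share i0 receives the environment of the last share, the other shares get
   0 extra qubits; this keeps the merged adversary uniform in i. *)
Definition rq (i : 'I_t) : nat := if i == i0 then q None else 0%N.

Lemma rq_le i : (rq i <= q None)%N.
Proof. by rewrite /rq; case: ifP. Qed.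

Lemma rq_i0 : q None = rq i0.
Proof. by rewrite /rq eqxx. Qed.

Definition spread (c : Qreg (q None)) : {dffun forall i, Qreg (rq i)} :=
  [ffun i => [ffun j => c (widen_ord (rq_le i) j)]].
Definition collect (d : {dffun forall i, Qreg (rq i)}) : Qreg (q None) :=
  [ffun j => d i0 (cast_ord rq_i0 j)].

Lemma spreadK : cancel spread collect.
Proof.
move=> c; apply/ffunP => j; rewrite !ffunE; congr (c _); exact: val_inj.
Qed.

Lemma collectK : cancel collect spread.
Proof.
move=> d; apply/ffunP => i; apply/ffunP => j; rewrite !ffunE.
have [E|ne] := eqVneq i i0.
  by move: j; rewrite E => j; congr (d i0 _); apply: val_inj.
(* Away from [i0] the register has 0 qubits, so there is no position to compare. *)
by case: j => j lj; exfalso; move: lj; rewrite /rq (negPf ne).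
Qed.

Definition merged_map i (Y : Op (Qreg (ns i) * Qreg (q (Some i) + rq i))%type) :
    Op (Qreg (ns i) * (F (Some i) * Qreg (rq i)))%type := fun p p' =>
  Lam (Some i) (fun u u' => Y (u.1, qcat u.2 p.2.2) (u'.1, qcat u'.2 p'.2.2))
    (p.1, p.2.1) (p'.1, p'.2.1).

Definition merged_vec : Vec R {dffun forall i, Qreg (q (Some i) + rq i)} := fun z =>
  psi (@djoin _ (fun o => Qreg (q o)) [ffun i => qleft (z i)] (collect [ffun i => qright (z i)])).

Lemma cptp_merged_map i : cptp (@merged_map i).
Proof.
pose f (z : (Qreg (ns i) * Qreg (q (Some i))) * Qreg (rq i)) := (z.1.1, qcat z.1.2 z.2).
pose f' (z : Qreg (ns i) * Qreg (q (Some i) + rq i)) := ((z.1, qleft z.2), qright z.2).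
pose g (z : Qreg (ns i) * (F (Some i) * Qreg (rq i))) := ((z.1, z.2.1), z.2.2).
pose g' (z : (Qreg (ns i) * F (Some i)) * Qreg (rq i)) := (z.1.1, (z.1.2, z.2)).
have fK : cancel f f' by move=> [[x u] v]; rewrite /f /f' /= qleft_cat qright_cat.
have fK' : cancel f' f by move=> [x u]; rewrite /f /f' /= qcat_split.
have gK : cancel g g' by case=> x [].
have gK' : cancel g' g by case=> [[]].
exact: (cptp_comp (cptp_comp (cptp_oppull R fK fK') (cptp_idtens _ (cL (Some i))))
  (cptp_oppull R gK gK')).
Qed.

Lemma vnorm2_merged_vec : vnorm2 merged_vec = vnorm2 psi.
Proof.
rewrite /vnorm2 [RHS](reindex_can
  (f := fun z : {dffun forall i, Qreg (q (Some i) + rq i)} => @djoin _ (fun o => Qreg (q o))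
    [ffun i => qleft (z i)] (collect [ffun i => qright (z i)]))
  (g := fun y => [ffun i => qcat (y (Some i)) (spread (y None) i)])) // => [z|y].
  apply/ffunP => i; rewrite ffunE djoin_Some djoin_None collectK !ffunE.
  exact: qcat_split.
apply/ffunP => -[i|]; rewrite ffunE; first by rewrite !ffunE qleft_cat.
rewrite -[RHS]spreadK; congr (collect _); apply/ffunP => i.
by rewrite ffunE ffunE qright_cat.
Qed.

Definition zcat (z : {dffun forall i, (Qreg (ns i) * Qreg (q (Some i)))%type})
    (d : {dffun forall i, Qreg (rq i)}) :
  {dffun forall i, (Qreg (ns i) * Qreg (q (Some i) + rq i))%type} :=
  [ffun i => ((z i).1, qcat (z i).2 (d i))].

Lemma sum_zcat (V : nmodType)
    (G : {dffun forall i, (Qreg (ns i) * Qreg (q (Some i) + rq i))%type} -> V) :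
  \sum_z G z = \sum_z \sum_d G (zcat z d).
Proof.
rewrite pair_big (reindex (fun p => zcat p.1 p.2)) //=.
exists (fun z => ([ffun i => ((z i).1, qleft (z i).2)], [ffun i => qright (z i).2])).
  move=> [z d] _; congr (_, _); apply/ffunP => i; rewrite !ffunE /=.
    by rewrite qleft_cat; case: (z i).
  by rewrite qright_cat.
move=> z _; apply/ffunP => i; rewrite !ffunE /= qcat_split; by case: (z i).
Qed.

(** A block of the tampered codeword before decoding: reference indices [h], [h'] and stored qubits
    [c], [c'] may be off-diagonal, while the environments [phi] are diagonal because they will be
    traced out. *)
Definition tampered (s : Op K) h h' (phi : {dffun forall i, F (Some i)}) c c' :
    Op {dffun forall i, Qreg (ns i)} := fun x x' =>
  \sum_(z : {dffun forall i, (Qreg (ns i) * Qreg (q (Some i)))%type}) \sum_z'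
    (Enc (fun i j => purif s (i, h) (j, h')) (dfst z) (dfst z') *
     (psi (@djoin _ (fun o => Qreg (q o)) (dsnd z) c) *
      (psi (@djoin _ (fun o => Qreg (q o)) (dsnd z') c'))^*)) *
    \prod_i Lam (Some i) (unitop R (z i) (z' i)) (x i, phi i) (x' i, phi i).

Lemma merged_map_unit i (z z' : Qreg (ns i) * Qreg (q (Some i))) d d' x f b x' f' b' :
  @merged_map i (unitop R (z.1, qcat z.2 d) (z'.1, qcat z'.2 d')) (x, (f, b)) (x', (f', b')) =
  Lam (Some i) (unitop R z z') (x, f) (x', f') * ((d == b)%:R * (d' == b')%:R).
Proof.
rewrite /merged_map mulrC.
have lS := lin_scale (cptp_lin (cL (Some i))) ((d == b)%:R * (d' == b')%:R) (unitop R z z').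
transitivity (Lam (Some i) (fun i1 j => (d == b)%:R * (d' == b')%:R * unitop R z z' i1 j) (x, f) (x', f')); last by rewrite lS.
congr (Lam (Some i) _ _ _); apply: opP => -[u1 u2] [u1' u2'].
case: z z' {lS} => [z1 z2] [z1' z2'].
rewrite /unitop -!natrM !mulnb !xpair_eqE !qcat_eq /=.
rewrite [u2 == z2]eq_sym; congr (nat_of_bool _)%:R.
rewrite [b == d]eq_sym [b' == d']eq_sym [z2 == _]eq_sym.
by case: (u1 == z1); case: (u2 == z2); case: (d == b); case: (d' == b');
  case: (u1' == z1'); case: (u2' == z2').
Qed.

Lemma experiment_spread s m phi c h m' c' h' :
  experiment Enc Dec merged_map merged_vec s ((m, dzip phi (spread c)), h) ((m', dzip phi (spread c')), h') =
  Dec (tampered s h h' phi c c') m m'.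
Proof.
rewrite experimentE; congr (Dec _ m m'); apply: opP => x x'.
rewrite sum_zcat; apply: eq_bigr => z _.
under eq_bigr => d _ do rewrite sum_zcat.
rewrite exchange_big; apply: eq_bigr => z' _ /=.
(* The handed-over qubits leave share 1 as they entered, which forces [d] and [d'] to equal
   [spread c] and [spread c']. *)
transitivity (\sum_d (\sum_d' ((Enc (fun i j => purif s (i, h) (j, h')) (dfst z) (dfst z') *
     (psi (@djoin _ (fun o => Qreg (q o)) (dsnd z) (collect d)) *
      (psi (@djoin _ (fun o => Qreg (q o)) (dsnd z') (collect d')))^*)) *
    \prod_i Lam (Some i) (unitop R (z i) (z' i)) (x i, phi i) (x' i, phi i)) *
    (d' == spread c')%:R) * (d == spread c)%:R).
  apply: eq_bigr => d _; rewrite mulr_suml; apply: eq_bigr => d' _.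
  have fz z1 d1 : dfst (zcat z1 d1) = dfst z1 by apply/ffunP => i; rewrite !ffunE.
  have pz z1 d1 : merged_vec (dsnd (zcat z1 d1)) = psi (@djoin _ (fun o => Qreg (q o)) (dsnd z1) (collect d1)).
    rewrite /merged_vec; congr (psi (djoin _ _)).
      by apply/ffunP => i; rewrite !ffunE qleft_cat.
    by congr (collect _); apply/ffunP => i; rewrite !ffunE qright_cat.
  rewrite !fz !pz -!mulrA; congr (_ * (_ * (_ * _))).
  rewrite -(prod_delta C d) -(prod_delta C d') -!big_split; apply: eq_bigr => i _ /=.
  rewrite [zcat z d i]ffunE [zcat z' d' i]ffunE [dzip _ _ i]ffunE [dzip _ _ i]ffunE.
  by rewrite merged_map_unit [X in _ = _ * X]mulrC.
by rewrite sum_delta_r sum_delta_r !spreadK.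
Qed.

Definition envN (Z : Op (E * Qreg (q None))%type) : Op E :=
  fun e e' => \sum_f Lam None Z (e, f) (e', f).

Lemma cptp_envN : cptp envN.
Proof.
have cp : cptp (fun (X : Op (E * F None)%type) e e' => \sum_f X (e, f) (e', f)).
  by apply: (@cptp_ptrace R _ _ (F None) (fun f e => (e, f)) (fun x => (x.2, x.1))) => // -[].
exact: (cptp_comp (cL None) cp).
Qed.

Definition sp (c : Qreg (q None)) : Qreg (rq i0) := spread c i0.
Definition sp' (b : Qreg (rq i0)) : Qreg (q None) := [ffun j => b (cast_ord rq_i0 j)].

Lemma spK : cancel sp sp'.
Proof. exact: spreadK. Qed.

Lemma sp'K : cancel sp' sp.
Proof.
move=> b; apply/ffunP => j; rewrite /sp !ffunE; congr (b _); exact: val_inj.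
Qed.

Lemma spread_unique c (d : {dffun forall i, Qreg (rq i)}) : d i0 = sp c -> d = spread c.
Proof.
by move=> E; rewrite -[d]collectK; congr spread; rewrite -(spK c) -E.
Qed.

(** Only share [i0] has stored qubits, so tracing out the other shares together with [F (Some i0)]
    is a sum over a common [phi], while [c] and [c'] remain free. *)
Lemma eta_spread (out : Op ((option K * {dffun forall i, (F (Some i) * Qreg (rq i))%type}) * K)%type)
    m h m' h' c c' :
  \sum_f @eta_MME R K _ (fun i => (F (Some i) * Qreg (rq i))%type) i0 out
     ((m, h), (f, sp c)) ((m', h'), (f, sp c')) =
  \sum_phi out ((m, dzip phi (spread c)), h) ((m', dzip phi (spread c')), h').
Proof.
rewrite [RHS](partition_big (fun phi : {dffun forall i, F (Some i)} => phi i0) predT) //=.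
apply: eq_bigr => f _; rewrite /eta_MME /=.
have zipP c1 (g : {dffun forall i, (F (Some i) * Qreg (rq i))%type}) : (g i0).2 = sp c1 ->
    dzip (dfst g) (spread c1) = g.
  move=> E; rewrite -(@spread_unique c1 (dsnd g)) ?ffunE //.
  by apply/ffunP => i; rewrite !ffunE; case: (g i).
rewrite (reindex_onto (fun phi => dzip phi (spread c)) (@dfst _ _ _)) => [|g /eqP E]; last first.
  by apply: zipP; rewrite E.
apply: eq_big => [phi|phi].
  by rewrite dfst_zip eqxx andbT ffunE xpair_eqE eqxx andbT.
(* Off [i0] the second index must copy the first, and at [i0] it is prescribed, so the inner sum has
   one term. *)
move=> /andP[/eqP E _]; apply: big_pred1 => g; rewrite /=.
have phi0 : phi i0 = f by move: E; rewrite ffunE => -[].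
apply/andP/eqP => [[/eqP gE /forallP gj]|->]; last first.
  split; first by rewrite ffunE phi0.
  apply/forallP => j; apply/implyP => nj; rewrite !ffunE xpair_eqE eqxx /=.
  by apply/eqP/ffunP => -[x lx]; exfalso; move: lx; rewrite /rq (negPf nj).
rewrite -(zipP c' g); last by rewrite gE.
congr dzip; apply/ffunP => j; rewrite ffunE.
have [->|nj] := eqVneq j i0; first by rewrite gE phi0.
by have := gj j; rewrite nj /= => /eqP->; rewrite ffunE.
Qed.

(** The factor of the last share splits off the product. Its input hatE occurs in what remains only
    as part of the reference index of the padded purification. *)
Lemma tampered_new s h h' phi fN x x' e e' : is_state s ->
  \sum_z \sum_z' (newEnc H Enc (fun i j => purif s (i, h) (j, h')) (dfst z) (dfst z') *
      (psi (dsnd z) * (psi (dsnd z'))^*)) *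
    \prod_o Lam o (unitop R (z o) (z' o)) (sh_join (x, e) o, djoin phi fN o)
      (sh_join (x', e') o, djoin phi fN o) =
  \sum_u \sum_u' Lam None (unitop R u u') (e, fN) (e', fN) *
    tampered (pad_mixed H s) (qjoin H h u.1) (qjoin H h' u'.1) phi u.2 u'.2 x x'.
Proof.
move=> ss; rewrite sum_djoin.
under eq_bigr => z _ do under eq_bigr => u _ do rewrite sum_djoin exchange_big.
rewrite exchange_big; apply: eq_bigr => u _ /=.
rewrite exchange_big; apply: eq_bigr => u' _ /=.
rewrite mulr_sumr; apply: eq_bigr => z _; rewrite mulr_sumr; apply: eq_bigr => z' _.
have spl z1 u1 : sh_split (dfst (djoin z1 u1)) = (dfst z1, u1.1) :> {dffun forall i, Qreg (ns i)} * E.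
  by congr (_, _); [apply/ffunP => i|]; rewrite !ffunE.
have snd z1 u1 : dsnd (@djoin _ (fun o => (Qreg (ext_ns ns l o) * Qreg (q o))%type) z1 u1) =
    @djoin _ (fun o => Qreg (q o)) (dsnd z1) u1.2.
  by apply/ffunP => -[i|]; rewrite !ffunE.
rewrite prod_option !snd !djoin_None mulrCA; congr (_ * _).
congr (_ * _); last by apply: eq_bigr => i _; rewrite !djoin_Some.
congr (_ * _); rewrite /newEnc /oppull !spl /idtens /=.
by congr (Enc _ _ _); apply: opP => w w'; apply: epr_prep_purif.
Qed.

(** Postponing the last tampering map is exact: it and the old decoder act on disjoint registers,
    and linearity exchanges them. *)
Lemma eta_new s : is_state s ->
  eta_MM (experiment (newEnc H Enc) (newDec H Dec) Lam psi s) =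
  recover H sp envN (@eta_MME R _ _ _ i0 (experiment Enc Dec merged_map merged_vec (pad_mixed H s))).
Proof.
move=> ss; apply: opP => -[o h] [o' h']; rewrite /eta_MM.
pose Y (f : {dffun forall o, F o}) : Op {dffun forall o, Qreg (ext_ns ns l o)} := fun y y' =>
  \sum_z \sum_z' (newEnc H Enc (fun i j => purif s (i, h) (j, h')) (dfst z) (dfst z') *
      (psi (dsnd z) * (psi (dsnd z'))^*)) *
    \prod_o Lam o (unitop R (z o) (z' o)) (y o, f o) (y' o, f o).
pose A f := @idtens R _ _ E Dec (oppull (@sh_join t ns l) (Y f)).
transitivity (\sum_f epr_check H (A f) o o').
  by apply: eq_bigr => f _; rewrite experimentE newDecE.
have := lin_bigsum A (@epr_check_lin R k l H).
move=> /(congr1 (fun g => g o o')) <-.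
rewrite /recover {1}/idtens; congr (epr_check H _ o o'); apply: opP => -[om e] [om' e'] /=.
rewrite sum_djoin exchange_big; apply: eq_bigr => fN _ /=.
pose D phi (u u' : E * Qreg (q None)) :=
  Dec (tampered (pad_mixed H s) (qjoin H h u.1) (qjoin H h' u'.1) phi u.2 u'.2) om om'.
have -> : (fun u u' => regroup H sp (@eta_MME R _ _ _ i0 (experiment Enc Dec merged_map merged_vec (pad_mixed H s)))
    (u, (om, h)) (u', (om', h'))) = (fun u u' => \sum_phi D phi u u').
  apply: opP => u u'; rewrite /regroup /= eta_spread; apply: eq_bigr => phi _.
  exact: experiment_spread.
(* On matrix units the last tampering map is a family of scalar coefficients, which can be moved
   inside [Dec]. *)
rewrite (lin_units (cptp_lin (cL None))).
under [RHS]eq_bigr => u _ do under eq_bigr => u' _ do rewrite mulr_suml.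
under [RHS]eq_bigr => u _ do rewrite exchange_big.
rewrite [RHS]exchange_big; apply: eq_bigr => phi _.
rewrite /A {1}/idtens /=.
have := lin_sum (cptp_lin cD)
  (fun p : (E * Qreg (q None)) * (E * Qreg (q None)) => Lam None (unitop R p.1 p.2) (e, fN) (e', fN))
  (fun p => tampered (pad_mixed H s) (qjoin H h p.1.1) (qjoin H h' p.2.1) phi p.1.2 p.2.2).
move=> /(congr1 (fun g => g om om')); rewrite pair_sum /= => DE.
under [RHS]eq_bigr => u _ do under eq_bigr => u' _ do rewrite mulrC.
rewrite -[RHS]DE; congr (Dec _ om om'); apply: opP => x x'.
by rewrite pair_sum; apply: tampered_new.
Qed.

End Reduction.

End Experiment.

(** * Tamper detection *)

Section Security.
Variable R : realType.
Local Notation C := R[i].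
Local Notation Op := (Op R).
Implicit Types T U : finType.

Lemma optr_tens T U (A : Op T) (B : Op U) :
  optr (fun p p' : T * U => A p.1 p'.1 * B p.2 p'.2) = optr A * optr B.
Proof.
rewrite /optr pair_sum mulr_suml; apply: eq_bigr => i _; by rewrite mulr_sumr.
Qed.

Lemma psd_tens T U (A : Op T) (B : Op U) : psd A -> psd B ->
  psd (fun p p' : T * U => A p.1 p'.1 * B p.2 p'.2).
Proof.
by move=> pA pB; exact: (psd_mul (psd_oppull (@fst T U) pA) (psd_oppull (@snd T U) pB)).
Qed.

Lemma psd_emb1 T U (A : Op (T * U)%type) : psd A -> psd (emb1 A).
Proof.
move=> pA; apply: psd_ext (psd_extend
  (fun p : option T * U => omap (fun t => (t, p.2)) p.1) pA).
by move=> [[t|] u] [[t'|] u'].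
Qed.

Lemma psd_botop T : psd (@botop R T).
Proof.
apply: psd_ext (psd_rank1 (fun o : option T => (o == None)%:R)) => o o'.
by rewrite conjC_nat -natrM mulnb.
Qed.

Lemma tr_botop T : optr (@botop R T) = 1.
Proof. by rewrite /optr sum_option /botop /= big1 ?addr0. Qed.

(** The condition that two environment indices agree off [i0] is symmetric, so the two sums can be
    exchanged. *)
Lemma eta_MME_herm (Mt I : finType) (F : I -> finType) (i0 : I)
    (out : Op ((option Mt * {dffun forall i, F i}) * Mt)%type) :
  Defs.hermitian out -> Defs.hermitian (@eta_MME R Mt I F i0 out).
Proof.
move=> /hermP ho; apply/hermP => r r'; rewrite /eta_MME.
rewrite (exchange_big_dep (fun f : {dffun forall i, F i} => f i0 == r.2)) /=; last first.
  by move=> f f' _ /andP[].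
rewrite rmorph_sum; apply: eq_bigr => f fr; rewrite rmorph_sum; apply: eq_big => f'.
  rewrite fr /=; congr (_ && _); apply: eq_forallb => j.
  by rewrite [f' j == _]eq_sym.
by move=> _; exact: ho.
Qed.

Lemma herm_sub T (A B : Op T) : Defs.hermitian A -> Defs.hermitian B ->
  Defs.hermitian (fun i j => A i j - B i j).
Proof. by move=> /hermP hA /hermP hB; apply/hermP => i j; rewrite rmorphB /= hA hB. Qed.

Lemma td_secure_new (k l : nat) (H : (l <= k)%N) (t : nat) (i0 : 'I_t)
    (ns e : 'I_t -> nat) (eps : R) (a : nat)
    (Enc : Op (Qreg k) -> Op {dffun forall i, Qreg (ns i)})
    (Dec : Op {dffun forall i, Qreg (ns i)} -> Op (option (Qreg k))) :
  cptp Enc -> cptp Dec -> aug_secure Enc Dec e i0 eps -> (a <= e i0)%N ->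
  td_secure (newEnc H Enc) (newDec H Dec) (ext_e e i0 a) (eps + 2 ^+ a.+1 / 2 ^+ l).
Proof.
move=> cE cD aug ae q F Lam psi [qe cL npsi].
have [|p [zeta [gam [/andP[p0 p1] sz sg hb]]]] := aug _ _ (@merged_map R l t ns i0 q F Lam) (@merged_vec R t i0 q psi).
  split=> [i|i|]; [|exact: cptp_merged_map|by rewrite vnorm2_merged_vec].
  (* Share [i0] ends with at most (e i0 - a) + a qubits; the truncated subtraction is exact because
     a <= e i0. *)
  have /= := qe (Some i); rewrite /rq; case: eqP => [->|_]; last by rewrite addn0.
  have /= qN := qe None; move=> qi.
  by rewrite (leq_trans (leq_add qi qN)) // subnK.
pose N := envN Lam; have cN : cptp N by exact: cptp_envN.
have spK0 := @spK _ i0 q; have sp'K0 := @sp'K _ i0 q.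
have [f [/andP[f0 f1] Hf]] := recover_same H spK0 sp'K0 cN sz.
(* The message survives when the old code is in its same part and the tampered EPR pairs pass the
   check. *)
exists (p * f); split.
  by rewrite mulr_ge0 //= mulr_ile1.
move=> s ss; rewrite (eta_new H i0 Enc psi cD cL ss).
pose sK := pad_mixed H s; have sKs : is_state sK by exact: state_pad.
set eta := @eta_MME R _ _ _ i0 _.
pose i1 : Op ((option (Qreg k) * Qreg k) * (F (Some i0) * Qreg (rq i0 q i0)))%type :=
  fun r r' => emb1 (purif sK) r.1 r'.1 * zeta r.2 r'.2.
pose i2 : Op ((option (Qreg k) * Qreg k) * (F (Some i0) * Qreg (rq i0 q i0)))%type :=
  fun r r' => gam (r.1.1, r.2) (r'.1.1, r'.2) * hat_marg sK r.1.2 r'.1.2.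
pose D := fun r r' => eta r r' - (p%:C%C * i1 r r' + (1 - p)%:C%C * i2 r r').
have Dle : trnorm D <= eps%:C%C by exact: hb.
have pC0 : 0 <= (1 - p)%:C%C by rewrite ler0c subr_ge0.
have hD : Defs.hermitian D.
  apply: herm_sub.
    apply: eta_MME_herm; apply: experiment_herm => //; exact: cptp_merged_map.
  have pi1 : psd i1.
    apply: psd_tens; last by case: sz.
    by apply: psd_emb1; case: (state_purif sKs).
  have pi2 : psd i2.
    exact: (psd_mul
      (psd_oppull (fun r : (option (Qreg k) * Qreg k) * _ => (r.1.1, r.2)) (proj1 sg))
      (psd_oppull (fun r => r.1.2) (proj1 (state_hat_marg sKs)))).
  have p0C : 0 <= p%:C%C by rewrite ler0c.
  by case: (psd_add (psd_scale p0C pi1) (psd_scale pC0 pi2)).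
pose om := fresh (sp i0 (q := q)) N gam.
have sf : is_state om by exact: state_fresh.
pose S := epr_block H om.
pose omS : Op (option (Qreg (k - l))) := fun o o' =>
  if o is Some m then if o' is Some m' then S m m' else 0 else 0.
have [pc tc] := cptp_state (cptp_epr_check R H) sf.
have pS : psd S by exact: (psd_oppull Some pc).
have pomS : psd omS by exact: (psd_extend id pS).
have tomS : optr omS = optr S by rewrite /optr sum_option add0r.
have omE o o' : epr_check H om o o' = omS o o' + (1 - optr S) * @botop R _ o o'.
  case: o => [m|]; case: o' => [m'|]; rewrite /epr_check /botop /= ?mulr0 ?addr0 //.
  by rewrite (proj2 sf) mulr1 add0r.
have [ph th] := state_hat_marg ss.
(* [P] is the fresh weight that wrongly passes the check, and [B] the same weight moved to bot. *)
pose P : Op (option (Qreg (k - l)) * Qreg (k - l))%type := fun r r' =>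
  (1 - p)%:C%C * (omS r.1 r'.1 * hat_marg s r.2 r'.2).
pose B : Op (option (Qreg (k - l)) * Qreg (k - l))%type := fun r r' =>
  ((1 - p)%:C%C * optr S) * (@botop R _ r.1 r'.1 * hat_marg s r.2 r'.2).
have pP : psd P by apply: psd_scale => //; exact: psd_tens.
have S0 : 0 <= optr S by exact: psd_tr_ge0.
have pB : psd B.
  apply: psd_scale; first exact: mulr_ge0.
  by apply: psd_tens => //; exact: psd_botop.
have cT := cptp_recover H (F (Some i0)) spK0 sp'K0 cN.
(* The bot weights combine by p(1 - f) + (1 - p) = 1 - pf; what is left beside the image of [D] is P
   - B. *)
have -> : (fun r r' => recover H (@sp _ i0 q) N eta r r' -
    ((p * f)%:C%C * emb1 (purif s) r r' +
     (1 - p * f)%:C%C * (@botop R _ r.1 r'.1 * hat_marg s r.2 r'.2))) =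
  (fun r r' => recover H (@sp _ i0 q) N D r r' + (P r r' - B r r')).
  have -> : eta = fun r r' => D r r' + (p%:C%C * i1 r r' + (1 - p)%:C%C * i2 r r').
    by apply: opP => r r'; rewrite /D subrK.
  have lT := cptp_lin cT.
  rewrite (lin_add lT D (fun r r' => p%:C%C * i1 r r' + (1 - p)%:C%C * i2 r r')).
  rewrite (lT p%:C%C i1 (fun r r' => (1 - p)%:C%C * i2 r r')) (lin_scale lT).
  rewrite (Hf s ss) (recover_fresh H (@sp _ i0 q) cN gam ss).
  apply: opP => r r'; rewrite -/om omE /P /B.
  rewrite !rmorphB !rmorphM rmorph1 /=; ring.
apply: le_trans (trnorm_cptp cT hD pP pB) _.
rewrite rmorphD /=; apply: lerD => //.
have trZ T (c : C) (A : Op T) : optr (fun i j => c * A i j) = c * optr A.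
  by rewrite /optr mulr_sumr.
have -> : optr P = (1 - p)%:C%C * optr S by rewrite trZ optr_tens tomS th mulr1.
have -> : optr B = (1 - p)%:C%C * optr S by rewrite trZ optr_tens tr_botop th mulr1 mulr1.
have Sle : optr S <= 2 ^+ a / 2 ^+ l.
  apply: le_trans (fresh_fidelity_le H spK0 sp'K0 cN sg) _.
  apply: ler_wpM2r; first by rewrite invr_ge0 dimE_ge0.
  rewrite card_Qreg natrX; apply: ler_weXn2l; first by rewrite ler1n.
  exact: (qe None).
(* [P] and [B] have equal traces, hence the factor 2 in front of the passing probability. *)
have -> : (2 ^+ a.+1 / 2 ^+ l)%:C%C = 2 * (2 ^+ a / 2 ^+ l) :> C.
  by rewrite rmorphM fmorphV !rmorphXn rmorph_nat exprS mulrA.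
rewrite -[X in X <= _]mulr2n -[X in X <= _]mulr_natl; apply: ler_wpM2l; first by rewrite ler0n.
apply: le_trans Sle; rewrite -[X in _ <= X]mul1r; apply: ler_wpM2r => //.
by rewrite rmorphB rmorph1 gerBl ler0c.
Qed.

End Security.

(* Shares of the t-share code are indexed by 'I_t (share 1 = Ordinal ht, of
   value 0); shares of the new (t+1)-share code are indexed by option 'I_t,
   with Some i the old share i and None the new (t+1)-st share hatE. *)
Theorem theorem3p2 (R : realType) (t : nat) (ht : (0 < t)%N)
    (n k : nat) (ns : 'I_t -> nat) (e : 'I_t -> nat) (eps : R)
    (Enc : Op R (Qreg k) -> Op R {dffun forall i, Qreg (ns i)})
    (Dec : Op R {dffun forall i, Qreg (ns i)} -> Op R (option (Qreg k)))
    (lam a : nat) (hlk : (lam < k)%N) :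
  (\sum_i ns i)%N = n ->
  is_code Enc Dec ->
  nm_secure Enc Dec e eps ->
  aug_secure Enc Dec e (Ordinal ht) eps ->
  (a <= minn lam (e (Ordinal ht)))%N ->
  [/\ is_code (newEnc (ltnW hlk) Enc) (newDec (ltnW hlk) Dec),
      (\sum_o ext_ns ns lam o)%N = (n + lam)%N &
      td_secure (newEnc (ltnW hlk) Enc) (newDec (ltnW hlk) Dec)
        (ext_e e (Ordinal ht) a) (eps + 2 ^+ a.+1 / 2 ^+ lam)].
Proof.
move=> nE code _ aug; rewrite leq_min => /andP[_ ae]; split.
- exact: is_code_new.
- by rewrite -nE addnC; exact: sum_option.
- by case: code => cE cD _; exact: td_secure_new.
Qed.
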